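(* Let $g\in\mathbb{N}_0$, and let $\mathcal{A}\subset C(\mathbb{T}_{g,q})$, $\mathcal{H}=\ell_2(\mathbb{N})\oplus\ell_2(\mathbb{N})$, $\pi:\mathcal{A}\to B(\mathcal{H})$ and $D$ be as defined in the context. Let $\{b_k:k\in\mathbb{Z}\}$ be the orthonormal basis of $\mathcal{H}$ given by $$b_k:=\tfrac{1}{\sqrt{2}}(e_{k-1}\oplus e_k),\qquad b_{-k}:=\tfrac{1}{\sqrt{2}}(-e_{k-1}\oplus e_k)\quad (k>0),\qquad b_0:=0\oplus e_0 .$$ Then the anti-unitary operator $J$ on $\mathcal{H}$ given by $Jb_k=b_{-k}$, $k\in\mathbb{Z}$, satisfies $$J^2=\mathrm{id},\qquad JD=-DJ,$$ and $$[\pi(a),J\pi(b)J^{-1}]\in\mathcal{K}_S(\mathcal{H}),\qquad [[D,\pi(a)],J\pi(b)J^{-1}]\in\mathcal{K}_S(\mathcal{H})\qquad\text{for all } a,b\in\mathcal{A}.$$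
   Context: Toeplitz algebra: Let $u(\mathrm{e}^{\mathrm{i}t})=\mathrm{e}^{\mathrm{i}t}$ be the unitary generator of $C(\mathbb{S}^1)\subset L_2(\mathbb{S}^1)$, and let $e_k=\frac{1}{\sqrt{2\pi}}u^k$, $k\in\mathbb{Z}$, be the standard orthonormal basis of $L_2(\mathbb{S}^1)$. Let $\ell_2(\mathbb{N}):=\overline{\mathrm{span}}\{e_n:n\in\mathbb{N}_0\}$ and let $P$ be the orthogonal projection from $L_2(\mathbb{S}^1)$ onto $\ell_2(\mathbb{N})$. For $f\in C(\mathbb{S}^1)$ define $T_f\in B(\ell_2(\mathbb{N}))$ by $T_f(\phi)=P(f\phi)$. The Toeplitz algebra $\mathcal{T}\subset B(\ell_2(\mathbb{N}))$ is the C*-algebra generated by all $T_f$, $f\in C(\mathbb{S}^1)$. It contains the compact operators $K(\ell_2(\mathbb{N}))$, and the symbol map $\sigma:\mathcal{T}\to C(\mathbb{S}^1)$ is the surjective $*$-homomorphism with kernel $K(\ell_2(\mathbb{N}))$ determined by $\sigma(T_f)=f$. Quantum surfaces: For $g\geq 1$ and $k=1,\ldots,2g$ define arcs $a_k,a_k^{-1}:[0,1]\to\mathbb{S}^1$ by $a_k(t)=\mathrm{e}^{\pi\mathrm{i}\frac{k-1+t}{2g}}$ and $a_k^{-1}(t)=\mathrm{e}^{\pi\mathrm{i}\frac{2g+k-t}{2g}}$. For $g=0$ use instead the single pair $a_0(t)=\mathrm{e}^{\pi\mathrm{i}t}$, $a_0^{-1}(t)=\mathrm{e}^{-\pi\mathrm{i}t}$.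 Let $C_g$ be the C*-algebra of all $f\in C(\mathbb{S}^1)$ such that $f(a_k(t))=f(a_k^{-1}(t))$ for all $t\in[0,1]$ and all $k=1,\ldots,2g$ (only $k=0$ if $g=0$). Define $C(\mathbb{T}_{g,q}):=\{x\in\mathcal{T}:\sigma(x)\in C_g\}$, a C*-subalgebra of $\mathcal{T}$. The algebra $\mathcal{A}$: Let $\mathcal{K}_S\subset K(\ell_2(\mathbb{N}))$ be the set of matrices of rapid decay, i.e. operators $A$ with $Ae_n=\sum_{k\in\mathbb{N}_0}a_{kn}e_k$ such that $\lim_{k+n\to\infty}|k^\alpha a_{kn}n^\beta|=0$ for all $\alpha,\beta\in\mathbb{N}_0$ (with $0^0=1$). Let $\mathcal{A}$ be the $*$-algebra generated by $\mathcal{K}_S$ and $\{T_f: f\in C^\infty(\mathbb{S}^1)\cap C_g\}$. Let $\mathcal{K}_S(\mathcal{H})\subset B(\mathcal{H})$ denote the matrices of rapid decay on $\mathcal{H}$, i.e. the operators $\begin{pmatrix}A_{11}&A_{12}\\ A_{21}&A_{22}\end{pmatrix}$ with all $A_{ij}\in\mathcal{K}_S$ (equivalently, the operators whose matrix with respect to the basis $\{b_k\}_{k\in\mathbb{Z}}$ is of rapid decay). Representation and Dirac operator: $\mathcal{H}:=\ell_2(\mathbb{N})\oplus\ell_2(\mathbb{N})$ and $\pi(a)(v_+\oplus v_-):=av_+\oplus av_-$. Let $S\in B(\ell_2(\mathbb{N}))$ be the shift $Se_k=e_{k+1}$, $k\in\mathbb{N}_0$, and let $N$ be the self-adjoint number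 operator $Ne_n=ne_n$ with $\mathrm{dom}(N)=\{\sum_n\alpha_ne_n\in\ell_2(\mathbb{N}):\sum_n n^2|\alpha_n|^2<\infty\}$. Define $D:=\begin{pmatrix}0&S^*N\\ NS&0\end{pmatrix}$ with $\mathrm{dom}(D)=\mathrm{dom}(N)\oplus\mathrm{dom}(N)$. For $a\in\mathcal{A}$, $[D,\pi(a)]$ denotes the bounded extension of the commutator. Anti-unitary operators are conjugate-linear, so $J(\sum_k\alpha_kb_k)=\sum_k\overline{\alpha_k}\,b_{-k}$. *)

(* Defs.v *)
From HB Require Import structures.
From mathcomp Require Import all_boot all_order all_algebra.
From mathcomp Require Import all_classical all_reals all_analysis.
From mathcomp Require Import complex ring.

Set Implicit Arguments.
Unset Strict Implicit.
Unset Printing Implicit Defensive.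

Import Order.TTheory GRing.Theory Num.Theory.
Import ComplexField.Normc.
Import numFieldNormedType.Exports.

Local Open Scope classical_set_scope.
Local Open Scope ring_scope.
Local Open Scope complex_scope.

(** * Operators on an inner product space

    Inner products are linear in the first argument and conjugate-linear in
    the second, as in [sesquilinear.v]. *)

Section Operators.
Variables (R : realType) (V : lmodType R[i]) (ip : V -> V -> R[i]).
Implicit Types (T : V -> V) (u v : V).

Definition ip_norm v : R := Num.sqrt (complex.Re (ip v v)).

Definition bounded_operator T : Prop :=
  (forall (a : R[i]) u v, T (a *: u + v) = a *: T u + T v) /\
  (exists M : R, forall v, ip_norm (T v) <= M * ip_norm v).

Definition is_adjoint T T' : Prop :=
  bounded_operator T' /\ forall u v, ip (T u) v = ip u (T' v).

(* The adjoint of a bounded operator of a Hilbert space exists and is unique,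
   so that the default value is never used there. *)
Definition adjoint T : V -> V := xget (fun=> 0) [set T' | is_adjoint T T'].

Definition antiunitary (J : V -> V) : Prop :=
  [/\ forall (a : R[i]) u v, J (a *: u + v) = conjc a *: J u + J v,
      forall u v, ip (J u) (J v) = conjc (ip u v)
    & forall v, exists u, J u = v].

Definition orthonormal_basis (I : eqType) (b : I -> V) : Prop :=
  (forall i j, ip (b i) (b j) = (i == j)%:R) /\
  (forall v (eps : R), 0 < eps -> exists (s : seq I) (c : I -> R[i]),
     ip_norm (v - \sum_(i <- s) c i *: b i) < eps).

Definition commutator T T' : V -> V := fun v => T (T' v) - T' (T v).

Inductive star_algebra_generated (G : set (V -> V)) : (V -> V) -> Prop :=
| gen_incl T : G T -> star_algebra_generated G T
| gen_add T T' : star_algebra_generated G T -> star_algebra_generated G T' ->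
    star_algebra_generated G (fun v => T v + T' v)
| gen_scale (a : R[i]) T : star_algebra_generated G T ->
    star_algebra_generated G (fun v => a *: T v)
| gen_mul T T' : star_algebra_generated G T -> star_algebra_generated G T' ->
    star_algebra_generated G (T \o T')
| gen_star T : star_algebra_generated G T ->
    star_algebra_generated G (adjoint T).

(* Only the values of [pop_fun] on [pop_dom] are meaningful. *)
Record partial_operator := PartialOperator {
  pop_dom : set V;
  pop_fun :> V -> V }.

Definition pop_eq (A B : partial_operator) : Prop :=
  pop_dom A = pop_dom B /\ forall v, pop_dom A v -> A v = B v.

Definition pop_compl T (A : partial_operator) : partial_operator :=
  PartialOperator (pop_dom A) (fun v => T (A v)).

Definition pop_compr (A : partial_operator) T : partial_operator :=
  PartialOperator (T @^-1` pop_dom A) (fun v => A (T v)).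

Definition pop_opp (A : partial_operator) : partial_operator :=
  PartialOperator (pop_dom A) (fun v => - A v).

(* [C] is the bounded extension of the commutator [[A, T]], which is defined
   on the domain of [A].  It is unique when that domain is dense. *)
Definition bounded_commutator (A : partial_operator) T (C : V -> V) : Prop :=
  [/\ bounded_operator C,
      forall v, pop_dom A v -> pop_dom A (T v)
    & forall v, pop_dom A v -> C v = A (T v) - T (A v)].

End Operators.

(** * The Hilbert space of square-summable sequences

    An element of the closed span of the [e_n] is given by its sequence of
    coordinates with respect to the [e_n]. *)

Section Ell2.
Variable R : realType.
Implicit Types u v w : nat -> R[i].

Definition square_summable : {pred nat -> R[i]} :=
  fun v => `[< cvgn (series (fun n => normc (v n) ^+ 2)) >].

Lemma normc_ge0 (z : R[i]) : 0 <= normc z.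
Proof. by case: z => x y; exact: sqrtr_ge0. Qed.

Lemma square_summable_submod : submod_closed square_summable.
Proof.
split.
  apply/asboolP; rewrite (_ : (fun n => _) = cst 0); last first.
    by apply/funext => n /=; rewrite expr0n /= addr0 sqrtr0 expr0n.
  rewrite (_ : series _ = cst 0); first exact: is_cvg_cst.
  by apply/funext => n; rewrite seriesEnat /= big1.
move=> a u v /asboolP cu /asboolP cv; apply/asboolP.
apply: (@series_le_cvg _ _ (fun n => 2 * normc a ^+ 2 * normc (u n) ^+ 2
   + 2 * normc (v n) ^+ 2)) => [n|n|n|].
- exact: sqr_ge0.
- apply: addr_ge0; last exact: mulr_ge0 (ler0n _ 2) (sqr_ge0 _).
  exact: mulr_ge0 (mulr_ge0 (ler0n _ 2) (sqr_ge0 _)) (sqr_ge0 _).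
- have h : normc (a * u n + v n) <= normc a * normc (u n) + normc (v n).
    by rewrite -normcM; exact: le_normcD.
  apply: (@le_trans _ _ ((normc a * normc (u n) + normc (v n)) ^+ 2)).
    by rewrite lerXn2r ?nnegrE ?addr_ge0 ?mulr_ge0 ?normc_ge0.
  rewrite -mulrA -exprMn; move: (normc a * _) (normc (v n)) => x y.
  rewrite -subr_ge0.
  by rewrite (_ : _ - _ = (x - y) ^+ 2) ?sqr_ge0 //; ring.
- have := is_cvg_seriesD (is_cvg_seriesZ (k := 2 * normc a ^+ 2) cu)
     (is_cvg_seriesZ (k := 2) cv).
  by apply: cvg_trans; apply: cvg_app.
Qed.

HB.instance Definition _ :=
  GRing.isSubmodClosed.Build R[i] (nat -> R[i]) square_summable
    square_summable_submod.

Record ell2 : Type := Ell2 {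
  ell2_val :> nat -> R[i];
  ell2_valP : ell2_val \in square_summable }.

HB.instance Definition _ := [isSub for ell2_val].
HB.instance Definition _ := [Choice of ell2 by <:].
HB.instance Definition _ := [SubChoice_isSubLmodule of ell2 by <:].

(* Only used for absolutely summable sequences. *)
Definition csum (w : nat -> R[i]) : R[i] :=
  limn (series (fun n => complex.Re (w n)))
  +i* limn (series (fun n => complex.Im (w n))).

Definition ell2_ip (v w : ell2) : R[i] := csum (fun n => v n * conjc (w n)).

Lemma basis_subproof (k : nat) :
  (fun n => (n == k)%:R : R[i]) \in square_summable.
Proof.
apply/asboolP; apply/cvg_ex; exists 1; apply: cvg_near_cst.
exists k.+1 => // m /= km; rewrite seriesEnat /= big_mkord.
rewrite (bigD1 (Ordinal km)) //= eqxx normc1 expr1n big1 ?addr0 // => i ik.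
rewrite (_ : (i == k :> nat) = false) ?normc0 ?expr0n //.
by apply/negP => /eqP ek; move/eqP: ik; apply; exact: val_inj.
Qed.

Definition e_ (k : nat) : ell2 := Ell2 (basis_subproof k).

Lemma right_shift_subproof (v : ell2) :
  (fun n => if n is m.+1 then v m else 0) \in square_summable.
Proof.
have /asboolP/cvg_ex[l cv] := ell2_valP v.
apply/asboolP; apply/cvg_ex; exists l; rewrite -cvg_shiftS.
apply: cvg_trans cv; apply: near_eq_cvg; apply: nearW => n /=.
by rewrite !seriesEnat /= big_nat_recl // normc0 expr0n add0r.
Qed.

Definition right_shift (v : ell2) : ell2 := Ell2 (right_shift_subproof v).

Definition number_op : partial_operator ell2 := {|
  pop_dom := [set v : ell2 | cvgn (series (fun n => n%:R ^+ 2 * normc (v n) ^+ 2))];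
  pop_fun := fun v : ell2 => insubd (0 : ell2) (fun n => n%:R * v n) |}.

(* The entry of [A] in row [k] and column [n] is [A (e_ n) k]. *)
Definition rapid_decay (A : ell2 -> ell2) : Prop :=
  bounded_operator ell2_ip A /\
  forall (alpha beta : nat) (eps : R), 0 < eps ->
    exists M : nat, forall k n : nat, (M <= k + n)%N ->
      normc (k%:R ^+ alpha * A (e_ n) k * n%:R ^+ beta) < eps.

End Ell2.

(** * Functions on the circle

    A function on the unit circle is a function [R[i] -> R[i]] of which only
    the values on the circle matter.  Integration on the circle is with respect
    to [dt] on [[0, 2 pi]], so that the total mass is [2 pi]. *)

Section Circle.
Variable R : realType.
Implicit Types (f phi psi : R[i] -> R[i]) (t : R).

Definition expi t : R[i] := cos t +i* sin t.

Definition re_circle f t : R := complex.Re (f (expi t)).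
Definition im_circle f t : R := complex.Im (f (expi t)).

Definition circle_continuous f : Prop :=
  continuous (re_circle f) /\ continuous (im_circle f).

(* All derivatives of [t |-> f (expi t)] exist. *)
Definition circle_smooth f : Prop := forall (n : nat) t,
  derivable (derive1n n (re_circle f)) t 1 /\ derivable (derive1n n (im_circle f)) t 1.

Definition circle_L2 phi : Prop :=
  [/\ measurable_fun `[0, 2 * pi]%classic (re_circle phi),
      measurable_fun `[0, 2 * pi]%classic (im_circle phi)
    & (\int[lebesgue_measure]_(t in `[0%R, (2 * pi)%R])
        ((normc (phi (expi t)) ^+ 2)%:E) < +oo)%E].

Definition circle_int phi : R[i] :=
  (\int[lebesgue_measure]_(t in `[0, 2 * pi]) re_circle phi t)
  +i* (\int[lebesgue_measure]_(t in `[0, 2 * pi]) im_circle phi t).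

Definition circle_ip phi psi : R[i] :=
  circle_int (fun z => phi z * conjc (psi z)).

Definition circle_norm phi : R := Num.sqrt (complex.Re (circle_ip phi phi)).

Definition circle_e (k : nat) : R[i] -> R[i] :=
  fun z => ((Num.sqrt (2 * pi))^-1)%:C * z ^+ k.

(* [phi] is a representative of the element of the Hardy space [ell2]
   whose coordinates are [v]: [phi = \sum_k v k *: circle_e k] in [L_2]. *)
Definition represents (v : ell2 R) phi : Prop :=
  circle_L2 phi /\
  (fun m => circle_norm (fun z => phi z - \sum_(k < m) v k * circle_e k z))
    @ \oo --> (0 : R).

(* [v] is the orthogonal projection of [psi] onto [ell2]. *)
Definition projects_to psi (v : ell2 R) : Prop :=
  forall n, v n = circle_ip psi (circle_e n).

Definition is_toeplitz f (T : ell2 R -> ell2 R) : Prop :=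
  bounded_operator (@ell2_ip R) T /\
  forall v phi, represents v phi -> projects_to (fun z => f z * phi z) (T v).

(** * Quantum surfaces *)

Definition edge (g k : nat) t : R[i] :=
  if g is 0%N then expi (pi * t)
  else expi (pi * ((k%:R - 1 + t) / (2 * g)%:R)).

Definition edge_inv (g k : nat) t : R[i] :=
  if g is 0%N then expi (- (pi * t))
  else expi (pi * (((2 * g)%:R + k%:R - t) / (2 * g)%:R)).

(* For [g = 0] the arcs do not depend on [k], whose only value is [0]. *)
Definition surface_index (g k : nat) : bool :=
  if g is 0%N then k == 0%N else (1 <= k <= 2 * g)%N.

Definition C_surface (g : nat) f : Prop :=
  circle_continuous f /\
  forall k t, surface_index g k -> 0 <= t <= 1 -> f (edge g k t) = f (edge_inv g k t).

Definition algA (g : nat) : set (ell2 R -> ell2 R) :=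
  star_algebra_generated (@ell2_ip R)
    (@rapid_decay R `|` [set T | exists f,
       [/\ circle_smooth f, C_surface g f & is_toeplitz f T]]).

End Circle.

(** * The representation and the Dirac operator *)

Section Dirac.
Variable R : realType.

Definition hilbert : Type := (ell2 R * ell2 R)%type.
HB.instance Definition _ := GRing.Lmodule.on hilbert.

Definition H_ip (v w : hilbert) : R[i] := ell2_ip v.1 w.1 + ell2_ip v.2 w.2.

Definition rep (a : ell2 R -> ell2 R) (v : hilbert) : hilbert := (a v.1, a v.2).

Definition rapid_decay_H (A : hilbert -> hilbert) : Prop :=
  exists A11 A12 A21 A22 : ell2 R -> ell2 R,
    [/\ rapid_decay A11, rapid_decay A12, rapid_decay A21, rapid_decay A22
      & forall v, A v = (A11 v.1 + A12 v.2, A21 v.1 + A22 v.2)].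

Definition dirac_op : partial_operator hilbert := {|
  pop_dom := [set v | pop_dom (number_op R) v.1 /\ pop_dom (number_op R) v.2];
  pop_fun := fun v =>
    (adjoint (@ell2_ip R) (@right_shift R) (number_op R v.2),
     number_op R (right_shift v.1)) |}.

(* [Negz k] is [- k.+1]. *)
Definition b_ (k : int) : hilbert :=
  match k with
  | Posz 0 => (0, e_ R 0)
  | Posz k.+1 => ((Num.sqrt 2)^-1)%:C *: (e_ R k, e_ R k.+1)
  | Negz k => ((Num.sqrt 2)^-1)%:C *: (- e_ R k, e_ R k.+1)
  end.

End Dirac.

(* Main.v *)
Require Import Defs.
From mathcomp Require Import all_boot all_order all_algebra.
From mathcomp Require Import all_classical all_reals all_analysis.
From mathcomp Require Import measurable_realfun complex ring lra zify.

(** The Hilbert space is a sum of two copies of the space of square-summable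
    sequences, and in this decomposition the antiunitary operator with
    [J b_k = b_(-k)] is [(v, w) |-> (- conj v, conj w)] ([reality]); this is the
    only one, since products with the basis [b_k] determine a vector.  Hence
    [J^2 = 1], and [J] anticommutes with the Dirac operator because the latter
    is off-diagonal with real entries.

    For an element [b] of the algebra, [J b J^-1] acts diagonally by the operator
    whose matrix is the complex conjugate of that of [b].  Both commutator
    statements thus become statements about matrices.  The relevant class
    ([toeplitz_mod]) consists of the bounded operators whose matrices decay
    rapidly away from the diagonal and whose increments along the diagonals
    decay rapidly in both indices; these are the Toeplitz operators with smooth
    symbol up to operators of rapid decay.  The class contains the generators
    of the algebra: for [T_f] with [f] smooth, the entries are Fourier
    coefficients of [f], which decrease rapidly by repeated integration by parts
    ([toeplitz_mod_symbol]).  It is closed under sums, products, adjoints and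
    complex conjugation, so that it contains the whole algebra
    ([algA_toeplitz_mod]) and all its conjugates.

    The key fact is that two operators of the class commute up to rapid decay
    ([commutator_rapid]): their symbols are functions, which commute, and the
    defect comes only from the truncation of the summation index in the matrix
    product to the nonnegative integers.  This gives the first commutator
    statement.  For the second, the entries of the commutator of the Dirac
    operator with [a] belong to the class again ([dirac_commutators]): the
    commutator of the number operator [N] with [a] has the entries
    [(k - n) a_(k n)], is bounded by Schur's test ([schur_test]), and stays in
    the class; the commutators with the shifts have rapid decay, so that their
    products with [N] are still of rapid decay.

    Matrix entries of products are limits of finite sums ([op_clim]), so that all
    estimates are made on finite sums and carried over by [clim_le]. *)

Set Implicit Arguments.
Unset Strict Implicit.
Unset Printing Implicit Defensive.

Import Order.TTheory GRing.Theory Num.Theory.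
Import ComplexField.Normc.
Import numFieldNormedType.Exports.

Local Open Scope ring_scope.

(** * Finite sums and limits of complex numbers *)

Section FiniteSums.
Variable R : realType.

(** Induction on [n]: the cross term of the last summand with the others is
    bounded by the inequality of the arithmetic and geometric means. *)
Lemma weighted_cauchy_schwarz n (w x y : nat -> R) : (forall i, 0 <= w i) ->
  (\sum_(i < n) w i * (x i * y i)) ^+ 2 <=
  (\sum_(i < n) w i * x i ^+ 2) * (\sum_(i < n) w i * y i ^+ 2).
Proof.
move=> w0; elim: n => [|n IHn]; first by rewrite !big_ord0 expr0n mul0r.
rewrite !big_ord_recr /=.
have X0 : 0 <= \sum_(i < n) w i * x i ^+ 2.
  by apply: sumr_ge0 => i _; rewrite mulr_ge0 ?sqr_ge0.
have Y0 : 0 <= \sum_(i < n) w i * y i ^+ 2.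
  by apply: sumr_ge0 => i _; rewrite mulr_ge0 ?sqr_ge0.
move: (\sum_(i < n) w i * x i ^+ 2) (\sum_(i < n) w i * y i ^+ 2) X0 Y0 IHn.
move: (\sum_(i < n) _) (w n) (w0 n) (x n) (y n) => P c c0 a b X Y X0 Y0 PXY.
have Pab : 2 * (P * (a * b)) <= X * b ^+ 2 + Y * a ^+ 2.
  apply: ler_normlW; rewrite -(@ler_pXn2r _ 2) ?nnegrE ?normr_ge0 //; last first.
    by rewrite addr_ge0 // mulr_ge0 ?sqr_ge0.
  rewrite -normrX ger0_norm ?sqr_ge0 //.
  have -> : (2 * (P * (a * b))) ^+ 2 = 4 * (a * b) ^+ 2 * P ^+ 2 by ring.
  apply: (@le_trans _ _ (4 * (a * b) ^+ 2 * (X * Y))).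
    by apply: ler_wpM2l => //; rewrite mulr_ge0 ?sqr_ge0.
  rewrite -subr_ge0.
  have -> : (X * b ^+ 2 + Y * a ^+ 2) ^+ 2 - 4 * (a * b) ^+ 2 * (X * Y)
    = (X * b ^+ 2 - Y * a ^+ 2) ^+ 2 by ring.
  exact: sqr_ge0.
have := ler_wpM2l c0 Pab.
rewrite -subr_ge0 => h; rewrite -subr_ge0.
have -> : (X + c * a ^+ 2) * (Y + c * b ^+ 2) - (P + c * (a * b)) ^+ 2 =
  (X * Y - P ^+ 2) + (c * (X * b ^+ 2 + Y * a ^+ 2) - c * (2 * (P * (a * b)))).
  by ring.
by rewrite addr_ge0 // subr_ge0.
Qed.

Lemma cauchy_schwarz n (x y : nat -> R) :
  (\sum_(i < n) x i * y i) ^+ 2 <=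
  (\sum_(i < n) x i ^+ 2) * (\sum_(i < n) y i ^+ 2).
Proof.
have := @weighted_cauchy_schwarz n (fun=> 1) x y (fun=> ler01).
by under eq_bigr do rewrite mul1r; under [X in _ <= X * _]eq_bigr do rewrite mul1r;
  under [X in _ <= _ * X]eq_bigr do rewrite mul1r.
Qed.

Lemma normc_sum (I : Type) (r : seq I) (P : pred I) (F : I -> R[i]) :
  normc (\sum_(i <- r | P i) F i) <= \sum_(i <- r | P i) normc (F i).
Proof.
apply: (big_ind2 (fun x y => normc x <= y)); first by rewrite normc0.
  by move=> x1 x2 y1 y2 h1 h2; apply: le_trans (le_normcD _ _) (lerD h1 h2).
by [].
Qed.

Lemma normc_conj (z : R[i]) : normc (conjc z) = normc z.
Proof. by case: z => a b /=; rewrite sqrrN. Qed.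

Lemma normc_sub (x y : R[i]) : normc (x - y) = normc (y - x).
Proof. by rewrite -normcN opprB. Qed.

Lemma normc_le0_eq0 (z : R[i]) : normc z <= 0 -> z = 0.
Proof. by move=> h; apply: eq0_normc; apply/eqP; rewrite eq_le h normc_ge0. Qed.

Lemma normc_real (x : R) : normc (x%:C)%C = `|x|.
Proof. by rewrite /= expr0n addr0 sqrtr_sqr. Qed.

Lemma normc_nat n : normc (n%:R : R[i]) = n%:R :> R.
Proof.
have -> : (n%:R : R[i]) = ((n%:R : R)%:C)%C by rewrite rmorph_nat.
by rewrite normc_real ger0_norm.
Qed.

Lemma normcX (z : R[i]) n : normc (z ^+ n) = normc z ^+ n.
Proof. by elim: n => [|n IH]; rewrite ?normc1 // !exprS normcM IH. Qed.

Lemma mulc_conj (z : R[i]) : z * conjc z = ((normc z ^+ 2)%:C)%C.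
Proof.
case: z => a b /=; rewrite sqr_sqrtr ?addr_ge0 ?sqr_ge0 //.
by apply/eqP; rewrite eq_complex /= mulrN opprK -!expr2 eqxx /= mulrN mulrC addNr.
Qed.

Lemma Re_le_normc (z : R[i]) : `|complex.Re z| <= normc z.
Proof.
case: z => a b /=; rewrite -(sqrtr_sqr a); apply: ler_wsqrtr.
by rewrite lerDl sqr_ge0.
Qed.

Lemma Im_le_normc (z : R[i]) : `|complex.Im z| <= normc z.
Proof.
case: z => a b /=; rewrite -(sqrtr_sqr b); apply: ler_wsqrtr.
by rewrite lerDr sqr_ge0.
Qed.

Lemma normc_le_ReIm (z : R[i]) : normc z <= `|complex.Re z| + `|complex.Im z|.
Proof.
case: z => a b /=; rewrite -[leRHS]ger0_norm ?addr_ge0 // -sqrtr_sqr.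
apply: ler_wsqrtr; rewrite sqrrD !real_normK ?num_real //.
by rewrite -addrA lerD2l lerDr mulrn_wge0 // mulr_ge0.
Qed.

End FiniteSums.

Section ComplexLimits.
Variable R : realType.
Implicit Types (u v : nat -> R[i]) (l : R[i]).

Definition clim u l : Prop := forall eps : R, 0 < eps ->
  exists M, forall m, (M <= m)%N -> normc (l - u m) < eps.

Lemma clim_near N u v l : (forall m, (N <= m)%N -> u m = v m) ->
  clim u l -> clim v l.
Proof.
move=> uv ul eps e0; have [M HM] := ul _ e0; exists (maxn M N) => m.
by rewrite geq_max => /andP[Mm Nm]; rewrite -uv // HM.
Qed.

Arguments clim_near N [u v l].

Lemma clim_cst l : clim (fun=> l) l.
Proof. by move=> eps e0; exists 0%N => m _; rewrite subrr normc0. Qed.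

Lemma climD u v l l' : clim u l -> clim v l' -> clim (fun m => u m + v m) (l + l').
Proof.
move=> ul vl eps e0; have e2 : 0 < eps / 2 by rewrite divr_gt0.
have [M HM] := ul _ e2; have [N HN] := vl _ e2; exists (maxn M N) => m.
rewrite geq_max => /andP[Mm Nm].
have -> : l + l' - (u m + v m) = (l - u m) + (l' - v m) by ring.
apply: le_lt_trans (le_normcD _ _) _.
by rewrite (splitr eps); apply: ltrD; [apply: HM|apply: HN].
Qed.

Lemma climZ (a : R[i]) u l : clim u l -> clim (fun m => a * u m) (a * l).
Proof.
move=> ul eps e0; have na : 0 < normc a + 1 by rewrite ltr_wpDl ?normc_ge0.
have [M HM] := ul _ (divr_gt0 e0 na).
exists M => m Mm; rewrite -mulrBr normcM.
have := HM _ Mm; rewrite ltr_pdivlMr // => h; apply: le_lt_trans h.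
by rewrite mulrC ler_wpM2l ?normc_ge0 // lerDl.
Qed.

Lemma climN u l : clim u l -> clim (fun m => - u m) (- l).
Proof.
move=> /(@climZ (-1)); rewrite mulN1r; apply: (@clim_near 0%N) => m _.
by rewrite mulN1r.
Qed.

Lemma clim_conj u l : clim u l -> clim (fun m => conjc (u m)) (conjc l).
Proof.
move=> ul eps e0; have [M HM] := ul _ e0.
by exists M => m Mm; rewrite -rmorphB normc_conj HM.
Qed.

Lemma clim_le u l (B : R) N : clim u l ->
  (forall m, (N <= m)%N -> normc (u m) <= B) -> normc l <= B.
Proof.
move=> ul uB; rewrite leNgt; apply/negP => Bl.
have e0 : 0 < normc l - B by rewrite subr_gt0.
have [M HM] := ul _ e0.
have h1 := HM (maxn M N) (leq_maxl _ _).
have h2 := uB (maxn M N) (leq_maxr _ _).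
have : normc l <= normc (l - u (maxn M N)) + normc (u (maxn M N)).
  by apply: le_trans (le_normcD _ _); rewrite subrK.
by lra.
Qed.

Lemma clim_unique u l l' : clim u l -> clim u l' -> l = l'.
Proof.
move=> ul ul'; apply/eqP; rewrite -subr_eq0; apply/eqP; apply: normc_le0_eq0.
have h := climD ul (climN ul').
apply: (clim_le h (N := 0%N)) => m _; by rewrite subrr normc0.
Qed.

End ComplexLimits.

(** * The inner product of square-summable sequences *)

#[local] Arguments ell2_ip : simpl never.
#[local] Arguments ip_norm : simpl never.
#[local] Arguments csum : simpl never.
#[local] Arguments normc : simpl never.
#[local] Arguments conjc : simpl never.
#[local] Arguments b_ : simpl never.

Section Ell2Theory.
Variable R : realType.
Implicit Types (u v w : ell2 R).

Local Notation ip := (@ell2_ip R).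
Local Notation nm := (ip_norm (@ell2_ip R)).

Lemma ell2P u v : (forall n, u n = v n) -> u = v.
Proof. by move=> h; apply: val_inj; apply/funext. Qed.

Lemma ell2D u v n : (u + v) n = u n + v n. Proof. by []. Qed.
Lemma ell2N u n : (- u) n = - u n. Proof. by []. Qed.
Lemma ell2B u v n : (u - v) n = u n - v n. Proof. by []. Qed.
Lemma ell2Z a u n : (a *: u) n = a * u n. Proof. by []. Qed.
Lemma ell20 n : (0 : ell2 R) n = 0. Proof. by []. Qed.
Lemma ell2_sum m (F : nat -> ell2 R) n :
  (\sum_(j < m) F j) n = \sum_(j < m) F j n.
Proof. by elim: m => [|m IH]; rewrite ?big_ord0 // !big_ord_recr /= -IH. Qed.
Lemma e_E k n : e_ R k n = (n == k)%:R. Proof. by []. Qed.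

Lemma series_ordE (f : nat -> R) m : series f m = \sum_(i < m) f i.
Proof. by rewrite seriesEnat /= big_mkord. Qed.

Lemma nneg_series_cvg (f : nat -> R) (B : R) : (forall i, 0 <= f i) ->
  (forall m, \sum_(i < m) f i <= B) -> cvgn (series f).
Proof.
move=> f0 fB; apply: nondecreasing_is_cvgn.
  by apply/nondecreasing_seqP => n; rewrite !series_ordE big_ord_recr /= lerDl.
by exists B => _ [m _ <-]; rewrite series_ordE.
Qed.

Lemma nneg_series_le (f : nat -> R) m : (forall i, 0 <= f i) ->
  cvgn (series f) -> \sum_(i < m) f i <= limn (series f).
Proof.
move=> f0 cf; rewrite -series_ordE; apply: nondecreasing_cvgn_le => //.
by apply/nondecreasing_seqP => n; rewrite !series_ordE big_ord_recr /= lerDl.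
Qed.

Lemma nneg_series_lim_le (f : nat -> R) B : cvgn (series f) ->
  (forall m, \sum_(i < m) f i <= B) -> limn (series f) <= B.
Proof.
by move=> cf fB; apply: limr_le => //; apply: nearW => m; rewrite series_ordE.
Qed.

Lemma square_summable_bound (f : nat -> R[i]) (B : R) :
  (forall m, \sum_(i < m) normc (f i) ^+ 2 <= B) -> f \in @square_summable R.
Proof.
by move=> fB; apply/asboolP; apply: nneg_series_cvg fB => i; apply: sqr_ge0.
Qed.

Lemma ell2_cvg v : cvgn (series (fun n => normc (v n) ^+ 2)).
Proof. exact/asboolP/(ell2_valP v). Qed.
Arguments ell2_cvg : clear implicits.

(** Links the sum by real and imaginary parts to limits of finite sums; all
    properties of the inner product are deduced from finite sums this way. *)
Lemma csum_clim (f : nat -> R[i]) : cvgn (series (fun n => normc (f n))) ->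
  clim (fun m => \sum_(j < m) f j) (csum f).
Proof.
move=> cf.
have cRe : cvgn (series (fun n => complex.Re (f n))).
  apply: normed_cvg; apply: series_le_cvg cf => n; rewrite ?Re_le_normc ?normc_ge0 //=.
have cIm : cvgn (series (fun n => complex.Im (f n))).
  apply: normed_cvg; apply: series_le_cvg cf => n; rewrite ?Im_le_normc ?normc_ge0 //=.
move=> eps e0; have e2 : 0 < eps / 2 by rewrite divr_gt0.
move/cvgrPdist_lt: cRe => /(_ _ e2)[M _ HM].
move/cvgrPdist_lt: cIm => /(_ _ e2)[N _ HN].
exists (maxn M N) => m; rewrite geq_max => /andP[Mm Nm].
have ReS : complex.Re (\sum_(j < m) f j) = series (fun n => complex.Re (f n)) m.
  rewrite series_ordE; elim: (m) => [|k IH]; rewrite ?big_ord0 //.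
  by rewrite !big_ord_recr /= -IH; case: (\sum_(_ < _) _) => ? ?; case: (f k).
have ImS : complex.Im (\sum_(j < m) f j) = series (fun n => complex.Im (f n)) m.
  rewrite series_ordE; elim: (m) => [|k IH]; rewrite ?big_ord0 //.
  by rewrite !big_ord_recr /= -IH; case: (\sum_(_ < _) _) => ? ?; case: (f k).
apply: le_lt_trans (normc_le_ReIm _) _.
rewrite /csum [X in _ - X]complexE; rewrite (splitr eps); apply: ltrD.
  have := HM m Mm; rewrite /= -ReS.
  by case: (\sum_(_ < _) _) => a b /=; rewrite !(mul0r, mulr0, addr0, subr0, mul1r, add0r).
have := HN m Nm; rewrite /= -ImS.
by case: (\sum_(_ < _) _) => a b /=; rewrite !(mul0r, mulr0, addr0, subr0, mul1r, add0r).
Qed.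

Definition ssq v := limn (series (fun n => normc (v n) ^+ 2)).

Lemma ssq_ge0 v : 0 <= ssq v.
Proof.
apply: le_trans (nneg_series_le 0%N _ (ell2_cvg v)); first by rewrite big_ord0.
by move=> i; apply: sqr_ge0.
Qed.

Lemma sum_le_ssq v m : \sum_(i < m) normc (v i) ^+ 2 <= ssq v.
Proof. by apply: nneg_series_le (ell2_cvg v) => i; apply: sqr_ge0. Qed.

Lemma ell2_normE v : nm v = Num.sqrt (ssq v).
Proof.
rewrite /ip_norm /ell2_ip /=; congr (Num.sqrt (limn (series _))).
by apply/funext => n; rewrite mulc_conj.
Qed.

Lemma ell2_norm_ge0 v : 0 <= nm v. Proof. exact: sqrtr_ge0. Qed.

Lemma sqr_norm v : nm v ^+ 2 = ssq v.
Proof. by rewrite ell2_normE sqr_sqrtr ?ssq_ge0. Qed.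

Lemma sum_le_norm v m : \sum_(i < m) normc (v i) ^+ 2 <= nm v ^+ 2.
Proof. by rewrite sqr_norm sum_le_ssq. Qed.

Lemma norm_le v (B : R) : 0 <= B ->
  (forall m, \sum_(i < m) normc (v i) ^+ 2 <= B ^+ 2) -> nm v <= B.
Proof.
move=> B0 h; rewrite -(@ler_pXn2r _ 2) ?nnegrE ?ell2_norm_ge0 // sqr_norm.
by apply: nneg_series_lim_le h; apply: ell2_cvg.
Qed.

Lemma coord_le_norm v k : normc (v k) <= nm v.
Proof.
rewrite -(@ler_pXn2r _ 2) ?nnegrE ?ell2_norm_ge0 ?normc_ge0 //.
apply: le_trans (sum_le_norm v k.+1); rewrite big_ord_recr /= lerDr.
by apply: sumr_ge0 => i _; apply: sqr_ge0.
Qed.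

Lemma sum_prod_le_norm u v m :
  \sum_(i < m) normc (u i) * normc (v i) <= nm u * nm v.
Proof.
have S0 : 0 <= \sum_(i < m) normc (u i) * normc (v i).
  by apply: sumr_ge0 => i _; rewrite mulr_ge0 ?normc_ge0.
rewrite -(@ler_pXn2r _ 2) ?nnegrE ?mulr_ge0 ?ell2_norm_ge0 //.
have /le_trans -> // := cauchy_schwarz m (fun i => normc (u i)) (fun i => normc (v i)).
rewrite exprMn; apply: ler_pM; rewrite ?sum_le_norm //.
  by apply: sumr_ge0 => i _; apply: sqr_ge0.
by apply: sumr_ge0 => i _; apply: sqr_ge0.
Qed.

Lemma ip_clim u v : clim (fun m => \sum_(j < m) u j * conjc (v j)) (ip u v).
Proof.
apply: csum_clim; apply: (@nneg_series_cvg _ (nm u * nm v)).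
  by move=> i; apply: normc_ge0.
move=> m; apply: le_trans (sum_prod_le_norm u v m).
by apply: ler_sum => i _; rewrite normcM normc_conj.
Qed.

Lemma ip_cauchy_schwarz u v : normc (ip u v) <= nm u * nm v.
Proof.
apply: (clim_le (@ip_clim u v) (N := 0%N)) => m _.
apply: le_trans (normc_sum _ _ _) _; apply: le_trans (sum_prod_le_norm u v m).
by apply: ler_sum => i _; rewrite normcM normc_conj.
Qed.

Lemma ipDl u u' v : ip (u + u') v = ip u v + ip u' v.
Proof.
apply: clim_unique (ip_clim _ _) _.
apply: (@clim_near _ 0%N) (climD (ip_clim u v) (ip_clim u' v)) => m _.
by rewrite -big_split; apply: eq_bigr => i _; rewrite ell2D mulrDl.
Qed.

Lemma ipZl a u v : ip (a *: u) v = a * ip u v.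
Proof.
apply: clim_unique (ip_clim _ _) _.
apply: (@clim_near _ 0%N) (climZ a (ip_clim u v)) => m _.
by rewrite mulr_sumr; apply: eq_bigr => i _; rewrite ell2Z mulrA.
Qed.

Lemma ipC u v : ip u v = conjc (ip v u).
Proof.
apply: clim_unique (ip_clim _ _) _.
apply: (@clim_near _ 0%N) (clim_conj (ip_clim v u)) => m _.
by rewrite rmorph_sum; apply: eq_bigr => i _; rewrite rmorphM /= conjcK mulrC.
Qed.

Lemma ipNl u v : ip (- u) v = - ip u v.
Proof. by rewrite -scaleN1r ipZl mulN1r. Qed.

Lemma ipBl u u' v : ip (u - u') v = ip u v - ip u' v.
Proof. by rewrite ipDl ipNl. Qed.

Lemma ipDr u v v' : ip u (v + v') = ip u v + ip u v'.
Proof.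
by rewrite ipC ipDl rmorphD [ip u v]ipC [ip u v']ipC.
Qed.

Lemma ipZr a u v : ip u (a *: v) = conjc a * ip u v.
Proof. by rewrite ipC ipZl rmorphM [ip u v]ipC. Qed.

Lemma ip0r u : ip u 0 = 0.
Proof. by rewrite -(scale0r (0 : ell2 R)) ipZr conjc0 mul0r. Qed.

Lemma ipNr u v : ip u (- v) = - ip u v.
Proof. by rewrite -scaleN1r ipZr rmorphN1 mulN1r. Qed.

Lemma ip_suml m (F : nat -> ell2 R) v :
  ip (\sum_(i < m) F i) v = \sum_(i < m) ip (F i) v.
Proof.
elim: m => [|m IH]; last by rewrite !big_ord_recr /= ipDl IH.
by rewrite !big_ord0 -(scale0r (0 : ell2 R)) ipZl mul0r.
Qed.

Lemma ip_sumr m (F : nat -> ell2 R) v :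
  ip v (\sum_(i < m) F i) = \sum_(i < m) ip v (F i).
Proof.
elim: m => [|m IH]; last by rewrite !big_ord_recr /= ipDr IH.
by rewrite !big_ord0 ip0r.
Qed.

Lemma ip_e_r v k : ip v (e_ R k) = v k.
Proof.
apply: clim_unique (ip_clim _ _) _.
apply: (@clim_near _ k.+1) (clim_cst (v k)) => m km.
symmetry; rewrite (bigD1 (Ordinal km)) //= ?e_E eqxx conjc1 mulr1 big1 ?addr0 //.
move=> i ik; rewrite ?e_E (_ : (i == k :> nat) = false) ?conjc0 ?mulr0 //.
by apply: contraNF ik => /eqP ik; apply/eqP/val_inj.
Qed.

Lemma ip_e_l v k : ip (e_ R k) v = conjc (v k).
Proof. by rewrite ipC ip_e_r. Qed.

Lemma ip_self v : ip v v = ((nm v ^+ 2)%:C)%C.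
Proof.
apply: clim_unique (ip_clim _ _) _.
move=> eps e0; have := ell2_cvg v => /cvgrPdist_lt/(_ _ e0)[M _ HM].
exists M => m Mm; have := HM m Mm.
rewrite -/(ssq v) sqr_norm series_ordE.
under [X in _ -> normc (_ - X) < _]eq_bigr do rewrite mulc_conj.
by rewrite -rmorph_sum -rmorphB normc_real.
Qed.

Lemma norm_triangle u v : nm (u + v) <= nm u + nm v.
Proof.
apply: norm_le => [|m]; first by rewrite addr_ge0 ?ell2_norm_ge0.
have := sum_le_norm u m; have := sum_le_norm v m; have := sum_prod_le_norm u v m.
rewrite sqrrD => h1 h2 h3.
apply: (@le_trans _ _ (\sum_(i < m) (normc (u i) ^+ 2 +
  (normc (u i) * normc (v i)) *+ 2 + normc (v i) ^+ 2))).
  apply: ler_sum => i _; rewrite -sqrrD ler_pXn2r ?nnegrE ?addr_ge0 ?normc_ge0 //.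
  by rewrite ell2D le_normcD.
by rewrite !big_split /= -mulr_natl; lra.
Qed.

Lemma normZ a v : nm (a *: v) = normc a * nm v.
Proof.
apply/eqP; rewrite -(@eqrXn2 _ 2) ?mulr_ge0 ?ell2_norm_ge0 ?normc_ge0 //; apply/eqP.
apply: complexI; rewrite -ip_self ipZl ipZr ip_self mulrA mulc_conj -rmorphM.
by rewrite exprMn.
Qed.

Definition trunc m v : ell2 R := \sum_(j < m) v j *: e_ R j.

Lemma truncE m v n : trunc m v n = if (n < m)%N then v n else 0.
Proof.
rewrite /trunc (ell2_sum m (fun j => v j *: e_ R j)).
under eq_bigr do rewrite ell2Z e_E.
elim: m => [|m IH]; first by rewrite big_ord0.
rewrite big_ord_recr /= IH ltnS [(n <= m)%N]leq_eqVlt.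
by case: eqVneq => [->|_]; rewrite ?ltnn ?add0r ?mulr1 //= mulr0 addr0.
Qed.

Lemma trunc_cvg v (eps : R) : 0 < eps ->
  exists M, forall m, (M <= m)%N -> nm (v - trunc m v) < eps.
Proof.
move=> e0; have e2 : 0 < (eps / 2) ^+ 2 by rewrite exprn_gt0 ?divr_gt0.
have := ell2_cvg v => /cvgrPdist_lt/(_ _ e2)[M _ HM].
exists M => m Mm; apply: (@le_lt_trans _ _ (eps / 2)); last by lra.
apply: norm_le => [|L]; first by rewrite divr_ge0 ?ltW.
have := HM m Mm; rewrite /= -/(ssq v) series_ordE => h.
apply: (@le_trans _ _ (ssq v - \sum_(i < m) normc (v i) ^+ 2)); last first.
  by rewrite ltW // (le_lt_trans _ h) // ler_norm.
rewrite lerBrDr; apply: le_trans (sum_le_ssq v (L + m)).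
have -> : \sum_(i < L) normc ((v - trunc m v) i) ^+ 2 =
    \sum_(i < L) (if (i < m)%N then 0 else normc (v i) ^+ 2).
  apply: eq_bigr => i _; rewrite ell2B truncE; case: ifP; last by rewrite subr0.
  by rewrite subrr normc0 expr0n.
have -> : \sum_(i < m) normc (v i) ^+ 2 =
    \sum_(i < L + m) (if (i < m)%N then normc (v i) ^+ 2 else 0).
  rewrite addnC big_split_ord /= [X in _ + X]big1 ?addr0; last first.
    by move=> i _; rewrite ltnNge leq_addr.
  by apply: eq_bigr => i _; rewrite ltn_ord.
have h3 : \sum_(i < L) (if (i < m)%N then 0 else normc (v i) ^+ 2) <=
    \sum_(i < L + m) (if (i < m)%N then 0 else normc (v i) ^+ 2).
  rewrite big_split_ord /= lerDl; apply: sumr_ge0 => i _.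
  by case: ifP => // _; apply: sqr_ge0.
apply: le_trans (lerD h3 (lexx _)) _; rewrite -big_split /=.
by apply: ler_sum => i _; case: ifP; rewrite ?add0r ?addr0.
Qed.

End Ell2Theory.

(** * Bounded operators and their adjoints *)

Section Operators.
Variable R : realType.
Implicit Types (u v w : ell2 R) (T : ell2 R -> ell2 R).

Local Notation ip := (@ell2_ip R).
Local Notation nm := (ip_norm (@ell2_ip R)).
Local Notation bounded := (bounded_operator (@ell2_ip R)).

Lemma bop0 T : bounded T -> T 0 = 0.
Proof. by move=> [/(_ (-1) 0 0)]; rewrite !scaleN1r !addNr. Qed.

Lemma bopD T u v : bounded T -> T (u + v) = T u + T v.
Proof. by move=> [/(_ 1 u v)]; rewrite !scale1r. Qed.

Lemma bopZ T a v : bounded T -> T (a *: v) = a *: T v.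
Proof. by move=> bT; have [/(_ a v 0)] := bT; rewrite (bop0 bT) !addr0. Qed.

Lemma bopN T v : bounded T -> T (- v) = - T v.
Proof. by move=> bT; rewrite -scaleN1r (bopZ _ _ bT) scaleN1r. Qed.

Lemma bopB T u v : bounded T -> T (u - v) = T u - T v.
Proof. by move=> bT; rewrite (bopD _ _ bT) (bopN _ bT). Qed.

Lemma bop_sum T m (F : nat -> ell2 R) : bounded T ->
  T (\sum_(j < m) F j) = \sum_(j < m) T (F j).
Proof.
move=> bT; elim: m => [|m IH]; first by rewrite !big_ord0 (bop0 bT).
by rewrite !big_ord_recr /= (bopD _ _ bT) IH.
Qed.

Lemma bop_bound T : bounded T -> exists2 M : R, 0 <= M & forall v, nm (T v) <= M * nm v.
Proof.
move=> [_ [M HM]]; exists `|M|; first exact: normr_ge0.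
move=> v; apply: le_trans (HM v) _; apply: ler_wpM2r; last exact: ler_norm.
exact: ell2_norm_ge0.
Qed.

Lemma bounded_id : bounded id.
Proof. by split => //; exists 1 => v; rewrite mul1r. Qed.

Lemma bounded_add T T' : bounded T -> bounded T' -> bounded (fun v => T v + T' v).
Proof.
move=> bT bT'; split.
  move=> a u v; rewrite (bopD _ _ bT) (bopD _ _ bT') (bopZ _ _ bT)
    (bopZ _ _ bT') scalerDr -!addrA; congr (_ + _).
  by rewrite addrCA.
have [[M _ HM] [N _ HN]] := (bop_bound bT, bop_bound bT').
exists (M + N) => v; rewrite mulrDl; apply: le_trans (norm_triangle _ _) _.
exact: lerD.
Qed.

Lemma bounded_scale (a : R[i]) T : bounded T -> bounded (fun v => a *: T v).
Proof.
move=> bT; split.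
  by move=> b u v; rewrite (bopD _ _ bT) (bopZ _ _ bT) scalerDr !scalerA mulrC.
have [M _ HM] := bop_bound bT.
exists (normc a * M) => v; rewrite normZ -mulrA.
by apply: ler_wpM2l; rewrite ?normc_ge0.
Qed.

Lemma bounded_comp T T' : bounded T -> bounded T' -> bounded (T \o T').
Proof.
move=> bT bT'; split.
  by move=> b u v /=; rewrite (bopD _ _ bT') (bopD _ _ bT) (bopZ _ _ bT') (bopZ _ _ bT).
have [[M M0 HM] [N _ HN]] := (bop_bound bT, bop_bound bT').
exists (M * N) => v; apply: le_trans (HM _) _; rewrite -mulrA.
exact: ler_wpM2l.
Qed.

Lemma bounded_sub T T' : bounded T -> bounded T' -> bounded (fun v => T v - T' v).
Proof.
move=> bT bT'; have := bounded_add bT (bounded_scale (-1) bT').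
by congr bounded_operator; apply/funext => v; rewrite scaleN1r.
Qed.

Lemma bounded_zero : bounded (fun=> 0).
Proof.
split; first by move=> a u v; rewrite scaler0 addr0.
exists 0 => v; rewrite mul0r; apply: norm_le => // m.
by rewrite big1 ?sqr_ge0 // => i _; rewrite ell20 normc0 expr0n.
Qed.

Lemma bounded_commutes T T' : bounded T -> bounded T' -> bounded (commutator T T').
Proof.
by move=> bT bT'; apply: (bounded_sub (bounded_comp bT bT') (bounded_comp bT' bT)).
Qed.

(** The truncations of [v] converge to [v] in norm.  Every computation with
    matrix entries rests on this: an estimate that holds for all the finite
    sums passes to the value [f v] by [clim_le]. *)
Lemma functional_clim (f : ell2 R -> R[i]) (M : R) v :
  (forall u w, f (u - w) = f u - f w) ->
  (forall m, f (trunc m v) = \sum_(j < m) v j * f (e_ R j)) ->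
  (forall u, normc (f u) <= M * nm u) ->
  clim (fun m => \sum_(j < m) v j * f (e_ R j)) (f v).
Proof.
move=> fB fT fM eps e0.
have M0 : 0 < `|M| + 1 by rewrite ltr_wpDl.
have [N HN] := trunc_cvg v (divr_gt0 e0 M0).
exists N => m Nm; rewrite -fT -fB; apply: le_lt_trans (fM _) _.
have := HN _ Nm; rewrite ltr_pdivlMr // => h; apply: le_lt_trans h.
rewrite mulrC ler_wpM2l ?ell2_norm_ge0 //.
by rewrite (le_trans (ler_norm M)) // lerDl.
Qed.

Lemma op_clim T v k : bounded T ->
  clim (fun m => \sum_(j < m) v j * T (e_ R j) k) (T v k).
Proof.
move=> bT; have [M M0 HM] := bop_bound bT.
apply: (@functional_clim (fun v => T v k) M).
- by move=> u w; rewrite (bopB _ _ bT).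
- move=> m; rewrite /trunc (bop_sum m (fun j => v j *: e_ R j)) //.
  rewrite (ell2_sum m (fun j => T (v j *: e_ R j))).
  by apply: eq_bigr => j _; rewrite (bopZ _ _ bT).
- by move=> u; apply: le_trans (coord_le_norm _ _) _.
Qed.

(** Duality between the synthesis map [x |-> \sum x k *: r k] and the
    coefficient map of a family: with [x k = ip v (r k)] and [w] the
    combination of the [r k] with these coefficients, the sum of the squares
    is [ip v w], which Cauchy-Schwarz bounds by [nm v * nm w].  Both the
    adjoint of a bounded operator and the operator of a matrix arise so. *)
Lemma coefficients_bound (r : nat -> ell2 R) (B : R) : 0 <= B ->
  (forall K (x : nat -> R[i]),
     nm (\sum_(k < K) x k *: r k) <= B * Num.sqrt (\sum_(k < K) normc (x k) ^+ 2)) ->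
  forall v m, \sum_(k < m) normc (ip v (r k)) ^+ 2 <= (B * nm v) ^+ 2.
Proof.
move=> B0 rB v m; pose x k := ip v (r k).
have := rB m x; set w := \sum_(k < m) _; rewrite -/x.
set s := \sum_(k < m) normc (x k) ^+ 2 => hw.
have s0 : 0 <= s by apply: sumr_ge0 => i _; apply: sqr_ge0.
have es : ip v w = (s%:C)%C.
  rewrite /w (ip_sumr m (fun k => x k *: r k)) /s [RHS]rmorph_sum.
  by apply: eq_bigr => k _; rewrite ipZr -/(x k) -[RHS]mulc_conj mulrC.
have : s <= nm v * (B * Num.sqrt s).
  apply: (@le_trans _ _ (nm v * nm w)); last first.
    by apply: ler_wpM2l => //; apply: ell2_norm_ge0.
  have := ip_cauchy_schwarz v w; rewrite es normc_real.
  by apply: le_trans; apply: ler_norm.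
rewrite -{1 3}(sqr_sqrtr s0); move: (Num.sqrt s) (sqrtr_ge0 s) => t t0.
rewrite le_eqVlt in t0; case/orP: t0 => [/eqP <- _|t0].
  by rewrite expr0n /= sqr_ge0.
rewrite expr2 mulrA ler_pM2r // => h.
rewrite -expr2 ler_pXn2r ?nnegrE ?mulr_ge0 ?ell2_norm_ge0 ?(ltW t0) //.
by rewrite mulrC.
Qed.

Lemma coefficients_operator (r : nat -> ell2 R) (B : R) : 0 <= B ->
  (forall K (x : nat -> R[i]),
     nm (\sum_(k < K) x k *: r k) <= B * Num.sqrt (\sum_(k < K) normc (x k) ^+ 2)) ->
  exists2 T, bounded T & forall v k, T v k = ip v (r k).
Proof.
move=> B0 rB; have cB := coefficients_bound B0 rB.
pose T v := @Ell2 R (fun k => ip v (r k)) (square_summable_bound (cB v)).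
exists T => //; split.
  by move=> a u v; apply: ell2P => k; rewrite ell2D ell2Z /T /= ipDl ipZl.
exists B => v; apply: norm_le => [|m]; last exact: cB.
by rewrite mulr_ge0 ?ell2_norm_ge0.
Qed.

Lemma norm_comb_e K (x : nat -> R[i]) :
  nm (\sum_(k < K) x k *: e_ R k) <= Num.sqrt (\sum_(k < K) normc (x k) ^+ 2).
Proof.
have s0 : 0 <= \sum_(k < K) normc (x k) ^+ 2.
  by apply: sumr_ge0 => i _; apply: sqr_ge0.
apply: norm_le => [|m]; first exact: sqrtr_ge0.
have xE n : (\sum_(k < K) x k *: e_ R k) n = if (n < K)%N then x n else 0.
  have xs : (fun n => if (n < K)%N then x n else 0) \in @square_summable R.
    apply: (@square_summable_bound _ _ (\sum_(k < K) normc (x k) ^+ 2)) => L.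
    elim: L => [|L IH]; first by rewrite big_ord0.
    have [LK|KL] := ltnP L K; last first.
      by rewrite big_ord_recr /= ltnNge KL /= normc0 expr0n addr0.
    have -> : \sum_(i < L.+1) normc (if (i < K)%N then x i else 0) ^+ 2
        = \sum_(i < L.+1) normc (x i) ^+ 2.
      by apply: eq_bigr => i _; rewrite (leq_trans (ltn_ord i)).
    rewrite -(subnKC LK) big_split_ord /= lerDl.
    by apply: sumr_ge0 => i _; apply: sqr_ge0.
  transitivity (trunc K (Ell2 xs) n); last by rewrite truncE /=; case: ltnP.
  by congr (ell2_val _ n); apply: eq_bigr => i _; rewrite /= ltn_ord.
rewrite sqr_sqrtr //; under eq_bigr do rewrite xE.
have [mK|Km] := leqP m K.
  rewrite -(subnKC mK) [leRHS]big_split_ord /=.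
  rewrite (eq_bigr (fun i : 'I_m => normc (x i) ^+ 2)); last first.
    by move=> i _; rewrite (leq_trans (ltn_ord i)) // leq_addr.
  by rewrite lerDl; apply: sumr_ge0 => i _; apply: sqr_ge0.
rewrite -(subnKC (ltnW Km)) big_split_ord /= [X in _ + X]big1 ?addr0; last first.
  by move=> i _; rewrite ltnNge leq_addr /= normc0 expr0n.
by rewrite (eq_bigr (fun i : 'I_K => normc (x i) ^+ 2)) // => i _; rewrite ltn_ord.
Qed.

(** The coordinates of the adjoint at [v] have to be the products of [v] with
    the images of the basis vectors. *)
Lemma adjointP T : bounded T -> is_adjoint ip T (adjoint ip T).
Proof.
move=> bT; apply: (@xgetPex _ _ [set T' | is_adjoint ip T T']%classic).
have [M M0 HM] := bop_bound bT.
have [|T' bT' T'E] := @coefficients_operator (fun k => T (e_ R k)) M M0.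
  move=> K x.
  have -> : \sum_(k < K) x k *: T (e_ R k) = T (\sum_(k < K) x k *: e_ R k).
    rewrite (bop_sum K (fun k => x k *: e_ R k)) //.
    by apply: eq_bigr => k _; rewrite (bopZ _ _ bT).
  by apply: le_trans (HM _) _; apply: ler_wpM2l => //; apply: norm_comb_e.
exists T'; split => // u v; symmetry; apply: clim_unique (ip_clim _ _) _.
have : clim (fun m => \sum_(j < m) u j * ip (T (e_ R j)) v) (ip (T u) v).
  apply: (@functional_clim (fun u => ip (T u) v) (M * nm v)).
  - by move=> w w'; rewrite (bopB _ _ bT) ipBl.
  - move=> m; rewrite /trunc (bop_sum m (fun j => u j *: e_ R j)) //.
    rewrite (ip_suml m (fun j => T (u j *: e_ R j))).
    by apply: eq_bigr => j _; rewrite (bopZ _ _ bT) ipZl.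
  - move=> w; apply: le_trans (ip_cauchy_schwarz _ _) _.
    by rewrite mulrAC; apply: ler_wpM2r; rewrite ?ell2_norm_ge0.
apply: (@clim_near _ 0%N) => m _; apply: eq_bigr => j _.
by rewrite T'E -ipC.
Qed.

Lemma adjoint_coord T v k : bounded T -> adjoint ip T v k = ip v (T (e_ R k)).
Proof.
by move=> bT; have [_ h] := adjointP bT; rewrite ipC h ip_e_l conjcK.
Qed.

Lemma bounded_adjoint T : bounded T -> bounded (adjoint ip T).
Proof. by case/adjointP. Qed.

Lemma adjoint_entry T k n : bounded T ->
  adjoint ip T (e_ R n) k = conjc (T (e_ R k) n).
Proof. by move=> bT; rewrite adjoint_coord // ip_e_l. Qed.

Local Notation S := (@right_shift R).
Local Notation L := (adjoint ip S).

Lemma right_shift_norm v : nm (S v) <= nm v.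
Proof.
apply: norm_le => [|m]; first exact: ell2_norm_ge0.
case: m => [|m]; first by rewrite big_ord0 sqr_ge0.
by rewrite big_ord_recl /= normc0 expr0n add0r; apply: sum_le_norm.
Qed.

Lemma bounded_right_shift : bounded S.
Proof.
split; last by exists 1 => v; rewrite mul1r; apply: right_shift_norm.
move=> a u v; apply: ell2P => -[|n]; rewrite ell2D ell2Z //.
by rewrite /= mulr0 addr0.
Qed.

Lemma right_shift_e k : S (e_ R k) = e_ R k.+1.
Proof. by apply: ell2P => -[|n]. Qed.

Lemma left_shiftE v k : L v k = v k.+1.
Proof.
by rewrite adjoint_coord ?right_shift_e ?ip_e_r //; apply: bounded_right_shift.
Qed.

Lemma bounded_left_shift : bounded L.
Proof. exact/bounded_adjoint/bounded_right_shift. Qed.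

End Operators.

(** * Matrices with weighted entries *)

(** Distance of the position [(k, n)] to the diagonal of a matrix.  All weights
    are natural numbers, so that the comparisons of weights are statements of
    elementary arithmetic. *)
Definition dist (k n : nat) : nat := (k - n) + (n - k).

Lemma distC k n : dist k n = dist n k. Proof. by rewrite /dist addnC. Qed.

Lemma dist_triangle k j n : ((dist k n).+1 <= (dist k j).+1 * (dist j n).+1)%N.
Proof. rewrite /dist; nia. Qed.

Lemma dist_leq k n : ((dist k n).+1 <= k.+1 * n.+1)%N.
Proof. rewrite /dist; nia. Qed.

Lemma leq_mul_dist k n : (k.+1 <= (dist k n).+1 * n.+1)%N.
Proof. rewrite /dist; nia. Qed.

Lemma leq_expl p m n : (m <= n)%N -> (m ^ p <= n ^ p)%N.
Proof. by case: p => // p mn; rewrite leq_exp2r. Qed.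

Lemma leq_expM a b c p : (a <= b * c -> a ^ p <= b ^ p * c ^ p)%N.
Proof. by move=> h; rewrite -expnMn leq_expl. Qed.

(** The spare factor [b ^ 2] makes the sum over the inner index of a matrix
    product converge. *)
Lemma leq_expM_sq a b c p : (a <= b * c -> a ^ p * b ^ 2 <= b ^ p.+2 * c ^ p)%N.
Proof.
move=> h; have -> : (b ^ p.+2 * c ^ p = b ^ p * c ^ p * b ^ 2)%N.
  by rewrite -(addn2 p) expnD mulnAC.
by apply: leq_mul => //; apply: leq_expM.
Qed.

Section Weights.
Variable R : realType.
Implicit Types (T : ell2 R -> ell2 R) (M : nat -> nat -> R[i]) (W : nat -> nat -> nat).

Local Notation ip := (@ell2_ip R).
Local Notation nm := (ip_norm (@ell2_ip R)).
Local Notation bounded := (bounded_operator (@ell2_ip R)).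

Lemma telescope_inv_square (x : R) : 0 < x -> ((x + 1) ^+ 2)^-1 <= x^-1 - (x + 1)^-1.
Proof.
move=> x0; have x1 : 0 < x + 1 by lra.
have -> : x^-1 - (x + 1)^-1 = (x * (x + 1))^-1 by field; rewrite !gt_eqF.
rewrite lef_pV2 ?posrE ?mulr_gt0 ?exprn_gt0 // expr2 ler_pM2r //; lra.
Qed.

(** Up to [j = k] the sum telescopes against [1 / (k - m + 1)], and beyond it
    against [3 - 1 / (m - k)]. *)
Lemma inv_square_sum k m : \sum_(j < m) (((dist k j).+1 ^ 2)%:R : R)^-1 <= 3.
Proof.
have low n : (n <= k)%N ->
    \sum_(j < n) (((dist k j).+1 ^ 2)%:R : R)^-1 <= ((k - n).+1%:R)^-1.
  elim: n => [|n IH] nk; first by rewrite big_ord0 invr_ge0.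
  rewrite big_ord_recr /=; have := IH (ltnW nk).
  have -> : dist k n = (k - n.+1).+1 by rewrite /dist; lia.
  have -> : (k - n).+1 = (k - n.+1).+2 by lia.
  have := @telescope_inv_square (k - n.+1).+1%:R (ltr0Sn _ _).
  rewrite natr1 natrX => h1 h2; apply: le_trans (lerD h2 h1) _.
  by rewrite addrC subrK.
have high n : \sum_(j < k + n.+1) (((dist k j).+1 ^ 2)%:R : R)^-1 <= 3 - (n.+1%:R)^-1.
  elim: n => [|n IH].
    rewrite addn1 big_ord_recr /=; have := low _ (leqnn k).
    by rewrite /dist subnn /= exp1n invr1; lra.
  rewrite addnS big_ord_recr /=.
  have -> : dist k (k + n.+1) = n.+1 by rewrite /dist; lia.
  have := @telescope_inv_square n.+1%:R (ltr0Sn _ _).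
  rewrite natr1 natrX => h; apply: le_trans (lerD IH h) _.
  by rewrite addrA subrK.
have [mk|km] := leqP m k.
  apply: le_trans (low _ mk) _; apply: (@le_trans _ _ 1); last by lra.
  by rewrite invf_le1 ?ltr0n // ler1n.
have := high (m - k).-1; rewrite (_ : (k + (m - k).-1.+1)%N = m); last by lia.
by move/le_trans; apply; rewrite gerBl invr_ge0.
Qed.

(** A bound uniform in [m] and in the center [c], which may be chosen to be the
    row or the column index of the entry under study. *)
Lemma sum_weight (F : nat -> R[i]) (w C : R) c m :
  (forall j, normc (F j) * w * ((dist c j).+1 ^ 2)%:R <= C) -> 0 <= w ->
  normc (\sum_(j < m) F j) * w <= 3 * C.
Proof.
move=> FC w0; have C0 : 0 <= C.
  by apply: le_trans (FC 0%N); rewrite !mulr_ge0 ?normc_ge0.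
have -> : 3 * C = C * 3 by rewrite mulrC.
apply: (@le_trans _ _ (\sum_(j < m) C * (((dist c j).+1 ^ 2)%:R : R)^-1)).
  apply: (@le_trans _ _ (\sum_(j < m) normc (F j) * w)).
    by rewrite -mulr_suml ler_wpM2r // normc_sum.
  apply: ler_sum => j _; rewrite ler_pdivlMr; first exact: FC.
  by rewrite ltr0n expn_gt0.
by rewrite -mulr_sumr ler_wpM2l // inv_square_sum.
Qed.

Lemma dist_normr k n : (dist k n)%:R = `|k%:R - n%:R| :> R.
Proof.
have [kn|/ltnW nk] := leqP k n.
  by rewrite distrC -natrB // ger0_norm // /dist; congr _%:R; lia.
by rewrite -natrB // ger0_norm // /dist; congr _%:R; lia.
Qed.

Definition weighted M W : Prop :=
  exists C : R, forall k n, normc (M k n) * (W k n)%:R <= C.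

Lemma weighted_ge0 M W : weighted M W ->
  exists2 C : R, 0 <= C & forall k n, normc (M k n) * (W k n)%:R <= C.
Proof.
move=> [C HC]; exists C => //; apply: le_trans (HC 0%N 0%N).
by rewrite mulr_ge0 ?normc_ge0.
Qed.

Lemma weighted_leq M W W' : (forall k n, W k n <= W' k n)%N ->
  weighted M W' -> weighted M W.
Proof.
move=> WW' [C HC]; exists C => k n; apply: le_trans (HC k n).
by apply: ler_wpM2l; rewrite ?normc_ge0 ?ler_nat.
Qed.

Lemma weighted_add M M' W : weighted M W -> weighted M' W ->
  weighted (fun k n => M k n + M' k n) W.
Proof.
move=> [C HC] [C' HC']; exists (C + C') => k n.
apply: le_trans (lerD (HC k n) (HC' k n)); rewrite -mulrDl.
by apply: ler_wpM2r; rewrite ?le_normcD.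
Qed.

Lemma weighted_scale (a : R[i]) M W : weighted M W ->
  weighted (fun k n => a * M k n) W.
Proof.
move=> [C HC]; exists (normc a * C) => k n; rewrite normcM -mulrA.
by apply: ler_wpM2l; rewrite ?normc_ge0.
Qed.

Definition mat T : nat -> nat -> R[i] := fun k n => T (e_ R n) k.

(** A weight [W] is carried by a product when [W k n] is dominated by weights of
    the factors along every path from [k] to [n] through [j], with room for the
    quadratic decay that [sum_weight] needs. *)
Lemma weighted_comp T T' W W1 W2 : bounded T ->
  (forall k j n, W k n * (dist k j).+1 ^ 2 <= W1 k j * W2 j n)%N ->
  weighted (mat T) W1 -> weighted (mat T') W2 -> weighted (mat (T \o T')) W.
Proof.
move=> bT WW /weighted_ge0[C C0 HC] /weighted_ge0[C' C0' HC'].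
exists (3 * (C * C')) => k n.
have [W0|W0] := posnP (W k n).
  by rewrite W0 mulr0 !mulr_ge0.
have Wpos : 0 < (W k n)%:R :> R by rewrite ltr0n.
rewrite -ler_pdivlMr // /mat /=.
apply: (@clim_le _ _ _ _ 0%N (op_clim (T' (e_ R n)) k bT)) => m _.
rewrite ler_pdivlMr //.
apply: (@sum_weight (fun j => T' (e_ R n) j * T (e_ R j) k) _ _ k) => [j|//].
rewrite normcM -mulrA -natrM.
apply: (@le_trans _ _ ((normc (mat T k j) * (W1 k j)%:R) * (normc (mat T' j n) * (W2 j n)%:R))).
  rewrite mulrACA -natrM [X in X * _ <= _]mulrC.
  by apply: ler_wpM2l; rewrite ?mulr_ge0 ?normc_ge0 ?ler_nat.
by apply: ler_pM; rewrite ?mulr_ge0 ?normc_ge0.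
Qed.

(** Schur's test: by a weighted Cauchy-Schwarz inequality, a matrix whose rows
    and columns have uniformly bounded absolute sums is a bounded operator. *)
Lemma schur_test M : weighted M (fun k n => (dist k n).+1 ^ 2)%N ->
  exists2 T, bounded T & forall k n, T (e_ R n) k = M k n.
Proof.
move=> /weighted_ge0[C C0 HC].
pose w (k n : nat) := (((dist k n).+1 ^ 2)%:R : R)^-1.
have w0 k n : 0 <= w k n by rewrite invr_ge0.
have wC k n : w k n = w n k by rewrite /w distC.
have Mw k n : normc (M k n) <= C * w k n.
  by rewrite ler_pdivlMr // ltr0n expn_gt0.
have w1 k n : w k n <= 1.
  by rewrite invf_le1 ?ltr0n ?expn_gt0 // ler1n expn_gt0.
have rows k : (fun n => conjc (M k n)) \in @square_summable R.
  apply: (@square_summable_bound _ _ (C ^+ 2 * 3)) => m.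
  apply: le_trans (ler_wpM2l (sqr_ge0 C) (inv_square_sum k m)).
  rewrite mulr_sumr; apply: ler_sum => n _; rewrite normc_conj.
  apply: (@le_trans _ _ ((C * w k n) ^+ 2)).
    by rewrite ler_pXn2r ?nnegrE ?normc_ge0 ?mulr_ge0.
  by rewrite exprMn ler_wpM2l ?sqr_ge0 // -/(w k n) expr2 ler_piMr.
pose r k := Ell2 (rows k).
have C3 : 0 <= C * 3 by rewrite mulr_ge0.
have [|T bT TE] := @coefficients_operator R r (C * 3) C3; last first.
  by exists T => // k n; rewrite TE ip_e_l conjcK.
move=> K x; have s0 : 0 <= \sum_(k < K) normc (x k) ^+ 2.
  by apply: sumr_ge0 => i _; apply: sqr_ge0.
apply: norm_le => [|m]; first by rewrite mulr_ge0 ?sqrtr_ge0.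
rewrite exprMn sqr_sqrtr //.
have step (n : nat) : normc ((\sum_(k < K) x k *: r k) n) ^+ 2 <=
    C ^+ 2 * 3 * \sum_(k < K) w n k * normc (x k) ^+ 2.
  apply: (@le_trans _ _ ((\sum_(k < K) C * (w n k * (1 * normc (x k)))) ^+ 2)).
    rewrite ler_pXn2r ?nnegrE ?normc_ge0 //; last first.
      by apply: sumr_ge0 => k _; rewrite !mulr_ge0 ?normc_ge0.
    rewrite (ell2_sum K (fun k => x k *: r k)); apply: le_trans (normc_sum _ _ _) _.
    apply: ler_sum => k _; rewrite ell2Z normcM normc_conj mul1r mulrA mulrC.
    by apply: ler_wpM2r; rewrite ?normc_ge0 // wC.
  rewrite -mulr_sumr exprMn -mulrA; apply: ler_wpM2l; first exact: sqr_ge0.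
  apply: le_trans (weighted_cauchy_schwarz K (fun=> 1) (fun k => normc (x k)) (w0 n)) _.
  apply: ler_wpM2r; first by apply: sumr_ge0 => k _; rewrite mulr_ge0 ?sqr_ge0.
  by under eq_bigr do rewrite expr1n mulr1; apply: inv_square_sum.
apply: (@le_trans _ _ (\sum_(n < m)
    C ^+ 2 * 3 * \sum_(k < K) w n k * normc (x k) ^+ 2)).
  by apply: ler_sum => n _; apply: step.
rewrite -mulr_sumr exchange_big /= [X in _ <= X * _]exprMn [3 ^+ 2]expr2.
rewrite [C ^+ 2 * (3 * 3)]mulrA -[leRHS]mulrA.
apply: ler_wpM2l; first by rewrite mulr_ge0 ?sqr_ge0.
rewrite mulr_sumr; apply: ler_sum => k _; rewrite -mulr_suml.
apply: ler_wpM2r; first exact: sqr_ge0.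
by under eq_bigr do rewrite wC; apply: inv_square_sum.
Qed.

End Weights.

(** * Toeplitz operators modulo rapid decay *)

Section Classes.
Variable R : realType.
Implicit Types (T : ell2 R -> ell2 R).

Local Notation ip := (@ell2_ip R).
Local Notation bounded := (bounded_operator (@ell2_ip R)).
Local Notation S := (@right_shift R).
Local Notation L := (adjoint ip S).

(** Operators with rapid decay away from the diagonal; they form an algebra in
    which the operators of rapid decay are an ideal. *)
Definition offdiag T : Prop :=
  bounded T /\ forall p, weighted (mat T) (fun k n => (dist k n).+1 ^ p)%N.

(** One exponent for both indices suffices, and the shift by one keeps the
    weight positive; [rapid_decayP] compares this with the limits. *)
Definition rapid T : Prop :=
  bounded T /\ forall p, weighted (mat T) (fun k n => (k.+1 * n.+1) ^ p)%N.

Lemma rapid_offdiag T : rapid T -> offdiag T.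
Proof.
move=> [bT wT]; split => // p; apply: weighted_leq (wT p) => k n.
exact/leq_expl/dist_leq.
Qed.

Lemma offdiag_add T T' : offdiag T -> offdiag T' -> offdiag (fun v => T v + T' v).
Proof.
move=> [bT wT] [bT' wT']; split => [|p]; first exact: bounded_add.
exact: (weighted_add (wT p) (wT' p)).
Qed.

Lemma offdiag_scale a T : offdiag T -> offdiag (fun v => a *: T v).
Proof.
move=> [bT wT]; split => [|p]; first exact: bounded_scale.
exact: (weighted_scale a (wT p)).
Qed.

Lemma rapid_add T T' : rapid T -> rapid T' -> rapid (fun v => T v + T' v).
Proof.
move=> [bT wT] [bT' wT']; split => [|p]; first exact: bounded_add.
exact: (weighted_add (wT p) (wT' p)).
Qed.

Lemma rapid_scale a T : rapid T -> rapid (fun v => a *: T v).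
Proof.
move=> [bT wT]; split => [|p]; first exact: bounded_scale.
exact: (weighted_scale a (wT p)).
Qed.

Lemma rapid_sub T T' : rapid T -> rapid T' -> rapid (fun v => T v - T' v).
Proof.
move=> rT /(rapid_scale (-1)) /(rapid_add rT).
by congr rapid; apply/funext => v; rewrite scaleN1r.
Qed.

Lemma rapid_zero : rapid (fun=> 0).
Proof.
split => [|p]; first exact: bounded_zero.
by exists 0 => k n; rewrite /mat ell20 normc0 mul0r.
Qed.

Lemma offdiag_comp T T' : offdiag T -> offdiag T' -> offdiag (T \o T').
Proof.
move=> [bT wT] [bT' wT']; split => [|p]; first exact: bounded_comp.
apply: weighted_comp (wT p.+2) (wT' p) => // k j n.
exact/leq_expM_sq/dist_triangle.
Qed.

Lemma offdiag_rapid T K : offdiag T -> rapid K -> rapid (T \o K).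
Proof.
move=> [bT wT] [bK wK]; split => [|p]; first exact: bounded_comp.
apply: weighted_comp (wT p.+2) (wK p) => // k j n.
by apply: leq_expM_sq; rewrite mulnA leq_mul // leq_mul_dist.
Qed.

Lemma rapid_offdiag_comp K T : rapid K -> offdiag T -> rapid (K \o T).
Proof.
move=> [bK wK] [bT wT]; split => [|p]; first exact: bounded_comp.
apply: weighted_comp (wK p.+2) (wT p) => // k j n.
apply: (@leq_trans ((k.+1 * n.+1) ^ p * (k.+1 * j.+1) ^ 2)).
  by rewrite leq_mul // leq_expl // dist_leq.
apply: leq_expM_sq; rewrite -mulnA leq_mul // mulnC distC; exact: leq_mul_dist.
Qed.

Lemma offdiag_adjoint T : offdiag T -> offdiag (adjoint ip T).
Proof.
move=> [bT wT]; split => [|p]; first exact: bounded_adjoint.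
have [C HC] := wT p; exists C => k n.
rewrite /mat adjoint_entry // normc_conj distC; exact: HC.
Qed.

(** The entries are the increments of the matrix of [T] along its diagonals, so
    that the displacement of a Toeplitz matrix vanishes. *)
Definition displacement T : ell2 R -> ell2 R := fun v => L (T (S v)) - T v.

(** Toeplitz matrices with rapidly decreasing symbol, modulo rapid decay.  The
    symbol is left implicit: stability under products then follows from ideal
    properties alone, without convolutions of symbols. *)
Definition toeplitz_mod T : Prop := offdiag T /\ rapid (displacement T).

Lemma displacement_entry T k n :
  displacement T (e_ R n) k = T (e_ R n.+1) k.+1 - T (e_ R n) k.
Proof. by rewrite /displacement ell2B left_shiftE right_shift_e. Qed.

Lemma left_right_shift v : L (S v) = v.
Proof. by apply: ell2P => k; rewrite left_shiftE. Qed.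

Lemma offdiag_right_shift : offdiag S.
Proof.
split => [|p]; first exact: bounded_right_shift.
exists (2 ^ p)%N%:R => k n; rewrite /mat right_shift_e e_E.
case: eqVneq => [->|_]; last by rewrite normc0 mul0r.
by rewrite normc1 mul1r ler_nat leq_expl // /dist; lia.
Qed.

Lemma offdiag_left_shift : offdiag L.
Proof. exact/offdiag_adjoint/offdiag_right_shift. Qed.

Lemma bounded_displacement T : bounded T -> bounded (displacement T).
Proof.
move=> bT; apply: bounded_sub => //; apply: (bounded_comp (bounded_left_shift R)).
exact: (bounded_comp bT (bounded_right_shift R)).
Qed.

Lemma rapid_displacement T : rapid T -> rapid (displacement T).
Proof.
move=> rT; apply: rapid_sub => //; apply: (offdiag_rapid offdiag_left_shift).
exact: (rapid_offdiag_comp rT offdiag_right_shift).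
Qed.

Lemma rapid_toeplitz_mod T : rapid T -> toeplitz_mod T.
Proof.
by move=> rT; split; [exact: rapid_offdiag|exact: rapid_displacement].
Qed.

Lemma toeplitz_mod_add T T' : toeplitz_mod T -> toeplitz_mod T' ->
  toeplitz_mod (fun v => T v + T' v).
Proof.
move=> [oT rT] [oT' rT']; split; first exact: offdiag_add.
have := rapid_add rT rT'; congr rapid; apply/funext => v; rewrite /displacement.
by rewrite (bopD _ _ (bounded_left_shift R)) opprD addrACA.
Qed.

Lemma toeplitz_mod_scale a T : toeplitz_mod T -> toeplitz_mod (fun v => a *: T v).
Proof.
move=> [oT rT]; split; first exact: offdiag_scale.
have := rapid_scale a rT; congr rapid; apply/funext => v; rewrite /displacement.
by rewrite (bopZ _ _ (bounded_left_shift R)) scalerBr.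
Qed.

(** The defect of [S \o L] from the identity is the projection onto [e_ 0]. *)
Lemma rapid_shift_defect : rapid (fun v => v - S (L v)).
Proof.
split=> [|p].
  apply: (bounded_sub (bounded_id R)).
  exact: (bounded_comp (bounded_right_shift R) (bounded_left_shift R)).
exists 1 => k n; rewrite /mat ell2B e_E; case: k => [|k] /=.
  rewrite subr0; case: eqVneq => [<-|_]; last by rewrite normc0 mul0r.
  by rewrite normc1 exp1n mulr1.
by rewrite left_shiftE e_E subrr normc0 mul0r.
Qed.

(** The displacement of a product obeys a Leibniz rule up to the defect of
    [S \o L] from the identity, which has rank one. *)
Lemma toeplitz_mod_comp T T' : toeplitz_mod T -> toeplitz_mod T' ->
  toeplitz_mod (T \o T').
Proof.
move=> [oT rT] [oT' rT']; split; first exact: offdiag_comp.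
have [[bT _] [bT' _]] := (oT, oT').
have oLTS : offdiag (L \o (T' \o S)).
  by apply: (offdiag_comp offdiag_left_shift (offdiag_comp oT' offdiag_right_shift)).
have r1 := rapid_offdiag_comp rT oLTS.
have r2 := offdiag_rapid oT rT'.
have r3 := offdiag_rapid (offdiag_comp offdiag_left_shift oT)
   (rapid_offdiag_comp rapid_shift_defect (offdiag_comp oT' offdiag_right_shift)).
have := rapid_add (rapid_add r1 r2) r3.
congr rapid; apply/funext => v; rewrite /displacement /=.
rewrite !(bopB _ _ bT) !(bopB _ _ (bounded_left_shift R)).
by rewrite [_ + (_ - T (T' v))]addrA subrK [RHS]addrC addrACA addrC !addrA subrK addrC.
Qed.

End Classes.

(** * Commutators modulo rapid decay *)

Lemma leq_addS_mul p q : ((p + q).+1 <= p.+1 * q.+1)%N.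
Proof. by rewrite mulSn mulnS addSn ltnS addnC leq_add2l leq_addr. Qed.

(** Convolution on an initial segment is commutative. *)
Lemma sum_reflect (R : comNzRingType) s (x y : nat -> R) :
  \sum_(j < s.+1) x (s - j)%N * y j = \sum_(j < s.+1) y (s - j)%N * x j.
Proof.
rewrite (reindex_inj rev_ord_inj); apply: eq_bigr => j _ /=.
have js : (j <= s)%N by rewrite -ltnS ltn_ord.
by rewrite subSS (subKn js) mulrC.
Qed.

Section Commutators.
Variable R : realType.
Implicit Types (T : ell2 R -> ell2 R) (a b : ell2 R -> ell2 R).

Local Notation ip := (@ell2_ip R).
Local Notation bounded := (bounded_operator (@ell2_ip R)).
Local Notation S := (@right_shift R).
Local Notation L := (adjoint ip S).

Lemma toeplitz_mod_adjoint T : toeplitz_mod T -> toeplitz_mod (adjoint ip T).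
Proof.
move=> [oT [_ wT]]; split; first exact: offdiag_adjoint.
have [bT _] := oT.
split=> [|p]; first exact/bounded_displacement/bounded_adjoint.
have [C HC] := wT p; exists C => k n; apply: le_trans (HC n k).
rewrite /mat !displacement_entry !adjoint_entry // -rmorphB normc_conj.
by rewrite mulnC.
Qed.

Lemma toeplitz_mod_right_shift : toeplitz_mod S.
Proof.
split; first exact: offdiag_right_shift.
have := rapid_zero R; congr rapid; apply/funext => v.
by rewrite /displacement left_right_shift subrr.
Qed.

Lemma toeplitz_mod_left_shift : toeplitz_mod L.
Proof. exact/toeplitz_mod_adjoint/toeplitz_mod_right_shift. Qed.

(** Summation of the displacement along a diagonal. *)
Lemma diagonal_increments T : toeplitz_mod T -> forall p,
  exists2 C : R, 0 <= C & forall k n m,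
    normc (T (e_ R n) k - T (e_ R (n + m)%N) (k + m)%N) * ((k.+1 * n.+1) ^ p)%N%:R <= C.
Proof.
move=> [_ [_ wT]] p; have [C C0 HC] := weighted_ge0 (wT p.+2).
exists (3 * C) => [|k n m]; first by rewrite mulr_ge0.
rewrite normc_sub.
have -> : T (e_ R (n + m)%N) (k + m)%N - T (e_ R n) k =
    \sum_(i < m) mat (displacement T) (k + i)%N (n + i)%N.
  elim: m => [|m IH]; first by rewrite big_ord0 !addn0 subrr.
  rewrite big_ord_recr /= -IH /mat displacement_entry !addnS; ring.
apply: (@sum_weight _ (fun i => mat (displacement T) (k + i)%N (n + i)%N) _ _ 0%N) => // i.
apply: le_trans (HC (k + i)%N (n + i)%N); rewrite -mulrA -natrM.
apply: ler_wpM2l; rewrite ?normc_ge0 // ler_nat.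
rewrite -[p.+2]addn2 expnD; apply: leq_mul; apply: leq_expl.
  by apply: leq_mul; rewrite ltnS leq_addr.
rewrite /dist sub0n subn0; apply: (@leq_trans (k + i).+1); first by rewrite ltnS leq_addl.
by rewrite leq_pmulr.
Qed.

(** The positions [(k, j)] and [(k + n - j, n)] lie on the same diagonal. *)
Lemma reflected_increments a : toeplitz_mod a -> forall p,
  exists2 C : R, 0 <= C & forall k n j, (j <= k + n)%N ->
    normc (a (e_ R j) k - a (e_ R n) (k + n - j)%N) * ((k.+1 * n.+1) ^ p)%N%:R
      <= C * ((dist n j).+1 ^ p)%N%:R.
Proof.
move=> ta p; have [C C0 HC] := diagonal_increments ta p; exists C => // k n j jkn.
have key (x : R) (w w' d : nat) : 0 <= x -> (w' <= w * d)%N -> x * w%:R <= C ->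
    x * w'%:R <= C * d%:R.
  move=> x0 ww h; apply: (@le_trans _ _ (x * (w * d)%N%:R)).
    by apply: ler_wpM2l; rewrite ?ler_nat.
  by rewrite natrM mulrA; apply: ler_wpM2r.
have [jn|nj] := leqP j n.
  have := HC k j (n - j)%N.
  rewrite subnKC // -addnBA // => h.
  apply: key h; rewrite ?normc_ge0 // -expnMn leq_expl //.
  by rewrite -mulnA leq_mul // mulnC leq_mul_dist.
have := HC (k + n - j)%N n (j - n)%N.
have njl := ltnW nj; rewrite (subnKC njl) (addnBA _ njl) (subnK jkn) addnK.
rewrite normc_sub => h; apply: key h; rewrite ?normc_ge0 // -expnMn leq_expl //.
rewrite mulnAC leq_mul //.
have ek : (k + n - j + (j - n) = k)%N by rewrite (addnBA _ njl) (subnK jkn) addnK.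
by rewrite /dist (eqP njl) add0n -{1}ek leq_addS_mul.
Qed.

Lemma reflected_sum a b : toeplitz_mod a -> offdiag b -> forall p,
  exists C : R, forall k n,
    normc (\sum_(j < (k + n).+1) (a (e_ R j) k - a (e_ R n) (k + n - j)%N) * b (e_ R n) j)
      * ((k.+1 * n.+1) ^ p)%N%:R <= C.
Proof.
move=> ta [_ wb] p; have [C C0 HC] := reflected_increments ta p.
have [C' C0' HC'] := weighted_ge0 (wb p.+2).
exists (3 * (C * C')) => k n.
pose F j := if (j <= k + n)%N
  then (a (e_ R j) k - a (e_ R n) (k + n - j)%N) * b (e_ R n) j else 0.
rewrite (eq_bigr (fun j : 'I__ => F j)); last by move=> j _; rewrite /F -ltnS ltn_ord.
apply: (@sum_weight _ F _ _ n) => // j; rewrite {}/F; case: leqP => jkn; last first.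
  by rewrite normc0 !mul0r mulr_ge0.
rewrite normcM [X in X * _]mulrAC -!mulrA.
apply: (@le_trans _ _ (C * ((dist n j).+1 ^ p)%N%:R *
    (normc (mat b j n) * ((dist n j).+1 ^ 2)%N%:R))).
  by rewrite mulrA; apply: ler_wpM2r; rewrite ?mulr_ge0 ?normc_ge0 // HC.
rewrite -mulrA; apply: ler_wpM2l => //; apply: le_trans (HC' j n).
by rewrite mulrCA -natrM -expnD addn2 distC.
Qed.

(** Decay in [k] comes from the factor [b] and decay in [n] from the factor [a]. *)
Lemma tail_sum a b : offdiag a -> offdiag b -> forall p,
  exists C : R, forall k n m,
    normc (\sum_(j < m) if (j <= k + n)%N then 0 else a (e_ R j) k * b (e_ R n) j)
      * ((k.+1 * n.+1) ^ p)%N%:R <= C.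
Proof.
move=> [_ wa] [_ wb] p; have [C C0 HC] := weighted_ge0 (wa p).
have [C' C0' HC'] := weighted_ge0 (wb p.+2).
exists (3 * (C * C')) => k n m.
pose F j := if (j <= k + n)%N then 0 else a (e_ R j) k * b (e_ R n) j.
apply: (@sum_weight _ F _ _ n) => // j; rewrite {}/F; case: leqP => jkn.
  by rewrite normc0 !mul0r mulr_ge0.
rewrite normcM; apply: (@le_trans _ _ ((normc (mat a k j) * ((dist k j).+1 ^ p)%N%:R) *
    (normc (mat b j n) * ((dist j n).+1 ^ p.+2)%N%:R))); last first.
  by apply: ler_pM; rewrite ?mulr_ge0 ?normc_ge0.
rewrite mulrACA -[leLHS]mulrA -!natrM.
apply: ler_wpM2l; rewrite ?mulr_ge0 ?normc_ge0 // ler_nat.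
rewrite -[p.+2]addn2 expnD mulnA distC; apply: leq_mul => //.
by rewrite -expnMn leq_expl // [(k.+1 * _)%N]mulnC leq_mul // /dist; lia.
Qed.

(** Multiplication operators on the circle commute, and compression to the
    Hardy space only truncates the summation index of the matrix product.  On
    the segment [j <= k + n] the reflection of [j] to [k + n - j] exchanges the
    two factors up to increments along diagonals ([reflected_sum]); for
    [k + n < j] the position [(k, j)] is farther than [n], and [(j, n)] farther
    than [k], from the diagonal ([tail_sum]). *)
Lemma commutator_rapid a b : toeplitz_mod a -> toeplitz_mod b ->
  rapid (commutator a b).
Proof.
move=> ta tb; have [[oa _] [ob _]] := (ta, tb).
have [[ba _] [bb _]] := (oa, ob).
split=> [|p]; first exact: bounded_commutes.
have [C1 H1] := reflected_sum ta ob p; have [C2 H2] := reflected_sum tb oa p.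
have [C3 H3] := tail_sum oa ob p; have [C4 H4] := tail_sum ob oa p.
exists (C1 + C2 + (C3 + C4)) => k n.
set w : R := (_ ^ _)%N%:R.
have w0 : 0 < w by rewrite ltr0n expn_gt0 muln_gt0.
rewrite -ler_pdivlMr //.
have cl := climD (op_clim (b (e_ R n)) k ba) (climN (op_clim (a (e_ R n)) k bb)).
(* The reflected segment has to be complete before it can be split off. *)
apply: (@clim_le _ _ _ _ (k + n).+1 cl) => m mkn.
rewrite ler_pdivlMr //.
pose P j := a (e_ R j) k * b (e_ R n) j; pose Q j := b (e_ R j) k * a (e_ R n) j.
have split_sum (F : nat -> R[i]) : \sum_(j < m) F j =
   \sum_(j < (k + n).+1) F j + \sum_(j < m) if (j <= k + n)%N then 0 else F j.
  rewrite -(subnKC mkn) !big_split_ord /=; congr (_ + _).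
  rewrite [X in _ = X + _]big1 ?add0r; last by move=> i _; rewrite -ltnS ltn_ord.
  by apply: eq_bigr => i _; rewrite ifF //; apply/negbTE; rewrite -ltnNge ltnS leq_addr.
have -> : \sum_(j < m) b (e_ R n) j * a (e_ R j) k -
    \sum_(j < m) a (e_ R n) j * b (e_ R j) k =
  (\sum_(j < (k + n).+1) (a (e_ R j) k - a (e_ R n) (k + n - j)%N) * b (e_ R n) j -
   \sum_(j < (k + n).+1) (b (e_ R j) k - b (e_ R n) (k + n - j)%N) * a (e_ R n) j) +
  ((\sum_(j < m) if (j <= k + n)%N then 0 else P j) -
   (\sum_(j < m) if (j <= k + n)%N then 0 else Q j)).
  under eq_bigr do rewrite mulrC.
  under [X in _ - X = _]eq_bigr do rewrite mulrC.
  rewrite (split_sum P) (split_sum Q) opprD addrACA; congr (_ + _).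
  under [X in _ = X - _]eq_bigr do rewrite mulrBl.
  under [X in _ = _ - X]eq_bigr do rewrite mulrBl.
  rewrite !sumrB.
  rewrite (sum_reflect (k + n) (a (e_ R n)) (b (e_ R n))).
  by rewrite opprB addrA subrK.
apply: le_trans (ler_wpM2r (ltW w0) (le_normcD _ _)) _; rewrite mulrDl.
apply: lerD; apply: le_trans (ler_wpM2r (ltW w0) (le_normcD _ _)) _;
  rewrite mulrDl normcN; apply: lerD.
- exact: H1.
- exact: H2.
- exact: H3.
- exact: H4.
Qed.

End Commutators.

(** * The number operator and the Dirac operator *)

Section NumberOperator.
Variable R : realType.
Implicit Types (T K : ell2 R -> ell2 R) (v w : ell2 R).

Local Notation ip := (@ell2_ip R).
Local Notation bounded := (bounded_operator (@ell2_ip R)).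
Local Notation S := (@right_shift R).
Local Notation L := (adjoint ip S).
Local Notation N := (number_op R).

(** Compares the weights [(i + 1)^p] used here with the powers [i^p], which
    vanish at [i = 0]. *)
Lemma succ_expn_le p i : ((i.+1 ^ p)%N%:R : R) <= (2 ^ p)%N%:R * (1 + i%:R ^+ p).
Proof.
rewrite -natrX -(natrD _ 1) -natrM ler_nat.
case: i => [|i]; first by rewrite exp1n muln_gt0 expn_gt0.
apply: (@leq_trans (2 ^ p * i.+1 ^ p)); last by rewrite leq_mul // leq_addl.
by rewrite -expnMn leq_expl //; lia.
Qed.

Lemma rapid_decayP T : rapid_decay T <-> rapid T.
Proof.
split=> [[bT dT]|[bT wT]]; split=> //; last first.
  move=> alpha beta eps e0.
  have [C C0 HC] := weighted_ge0 (wT (maxn alpha beta).+1).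
  have [M HM] : exists M : nat, C < M.+1%:R * eps.
    exists (Num.truncn (C / eps)); rewrite -ltr_pdivrMr //.
    exact: truncnS_gt.
  exists M => k n Mkn; rewrite !normcM !normcX !normc_nat.
  have kn0 : 0 < (k + n).+1%:R :> R by [].
  rewrite -(ltr_pM2r kn0); apply: (@le_lt_trans _ _ C); last first.
    apply: lt_le_trans HM _; rewrite mulrC; apply: ler_wpM2l; first exact: ltW.
    by rewrite ler_nat ltnS.
  apply: le_trans (HC k n).
  rewrite -/(mat T k n); set x := normc _.
  have -> : k%:R ^+ alpha * x * n%:R ^+ beta * (k + n).+1%:R =
      x * (k ^ alpha * n ^ beta * (k + n).+1)%N%:R.
    by rewrite !natrM !natrX; ring.
  apply: ler_wpM2l; rewrite ?normc_ge0 // ler_nat expnS mulnC.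
  apply: leq_mul; first exact: leq_addS_mul.
  have pow i e : (e <= maxn alpha beta -> i ^ e <= i.+1 ^ maxn alpha beta)%N.
    by move=> h; apply: leq_trans (leq_expl _ (leqnSn i)) _; apply: leq_pexp2l.
  by rewrite expnMn leq_mul // pow // ?leq_maxl ?leq_maxr.
move=> p.
have bnd alpha beta : exists C : R, forall k n,
    normc (k%:R ^+ alpha * T (e_ R n) k * n%:R ^+ beta) <= C.
  (* Beyond [M] the entries are at most 1; the others are finitely many. *)
  have [M HM] := dT alpha beta 1 ltr01.
  exists (1 + \sum_(k < M) \sum_(n < M)
     normc (k%:R ^+ alpha * T (e_ R n) k * n%:R ^+ beta)) => k n.
  have S0 (x y : nat -> nat -> R) : (forall i j, 0 <= x i j) ->
     0 <= \sum_(i < M) \sum_(j < M) x i j.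
    by move=> h; apply: sumr_ge0 => i _; apply: sumr_ge0.
  have [/HM h|knM] := leqP M (k + n).
    apply: le_trans (ltW h) _; rewrite lerDl; apply: sumr_ge0 => i _.
    by apply: sumr_ge0 => j _; apply: normc_ge0.
  have kM : (k < M)%N by lia.
  have nM : (n < M)%N by lia.
  apply: ler_wpDl => //; rewrite (bigD1 (Ordinal kM)) //= (bigD1 (Ordinal nM)) //=.
  rewrite -addrA lerDl addr_ge0 //; apply: sumr_ge0 => i _; rewrite ?normc_ge0 //.
  by apply: sumr_ge0 => j _; apply: normc_ge0.
have [[C1 H1] [C2 H2] [C3 H3] [C4 H4]] :=
  And4 (bnd 0%N 0%N) (bnd p 0%N) (bnd 0%N p) (bnd p p).
exists ((2 ^ p * 2 ^ p)%N%:R * (C1 + C2 + (C3 + C4))) => k n.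
have := H1 k n; have := H2 k n; have := H3 k n; have := H4 k n.
rewrite !normcM !normcX !normc_nat !expr0 !(mul1r, mulr1) -/(mat T k n).
move: (normc (mat T k n)) (normc_ge0 (mat T k n))
  (succ_expn_le p k) (succ_expn_le p n) => x x0.
rewrite expnMn natrM natrM.
have k0 : 0 <= (k%:R ^+ p : R) by [].
have n0 : 0 <= (n%:R ^+ p : R) by [].
move: (k%:R ^+ p) (n%:R ^+ p) k0 n0 => y z y0 z0 hy hz h4 h3 h2 h1.
apply: (@le_trans _ _ (x * ((2 ^ p)%N%:R * (1 + y) * ((2 ^ p)%N%:R * (1 + z))))).
  by apply: ler_wpM2l => //; apply: ler_pM.
have -> : x * ((2 ^ p)%N%:R * (1 + y) * ((2 ^ p)%N%:R * (1 + z))) =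
  (2 ^ p)%N%:R * (2 ^ p)%N%:R * (x + y * x + (x * z + y * x * z)) by ring.
by apply: ler_wpM2l; rewrite ?mulr_ge0 // !lerD.
Qed.

Lemma offdiag_of_matrix (M : nat -> nat -> R[i]) :
  (forall p, weighted M (fun k n => (dist k n).+1 ^ p)%N) ->
  exists2 T, offdiag T & forall k n, T (e_ R n) k = M k n.
Proof.
move=> wM; have [T bT TE] := schur_test (wM 2%N); exists T => //.
split=> // p; have [C HC] := wM p; exists C => k n; rewrite /mat TE; exact: HC.
Qed.

Lemma number_op_dom v w : (forall n, w n = n%:R * v n) ->
  pop_dom N v /\ N v = w.
Proof.
move=> wE; split.
  rewrite /=; have -> : (fun n => n%:R ^+ 2 * normc (v n) ^+ 2) =
      (fun n => normc (w n) ^+ 2).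
    by apply/funext => n; rewrite wE normcM normc_nat exprMn.
  exact: (@ell2_cvg _ w).
have vs : (fun n => n%:R * v n) \in @square_summable R.
  rewrite (_ : (fun n => _) = ell2_val w); first exact: ell2_valP.
  by apply/funext => k; rewrite wE.
apply: (@ell2P R (N v) w) => n; rewrite wE.
exact: (congr1 (fun f => f n) (insubdK (0 : ell2 R) vs)).
Qed.

Lemma number_opE v n : pop_dom N v -> N v n = n%:R * v n.
Proof.
move=> dv; have vs : (fun n => n%:R * v n) \in @square_summable R; last first.
  exact: (congr1 (fun f => f n) (insubdK (0 : ell2 R) vs)).
apply/asboolP; move: dv => /=.
have -> // : (fun n => n%:R ^+ 2 * normc (v n) ^+ 2) =
  (fun n => normc (n%:R * v n) ^+ 2).
by apply/funext => k; rewrite normcM normc_nat exprMn.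
Qed.

(** The commutator with the number operator multiplies the entry [(k, n)] by
    [k - n]; this preserves the decay away from the diagonal, hence boundedness,
    and it multiplies the displacement by [k - n] too. *)
Lemma number_commutator T : toeplitz_mod T ->
  exists2 A, toeplitz_mod A & forall v, pop_dom N v ->
    pop_dom N (T v) /\ N (T v) = T (N v) + A v.
Proof.
move=> [[bT oT] [_ rT]].
have nd k n : normc (k%:R - n%:R : R[i]) = (dist k n)%:R.
  rewrite dist_normr -normc_real; congr normc.
  by rewrite rmorphB !rmorph_nat.
have [|A [bA oA] AE] := @offdiag_of_matrix (fun k n => (k%:R - n%:R) * mat T k n).
  move=> p; have [C HC] := oT p.+1; exists C => k n; apply: le_trans (HC k n).
  rewrite normcM nd [X in X * _]mulrC -mulrA -natrM.
  by apply: ler_wpM2l; rewrite ?normc_ge0 // ler_nat expnS leq_mul.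
exists A.
  split=> //; split; first exact: bounded_displacement.
  move=> p; have [C HC] := rT p.+1; exists C => k n; apply: le_trans (HC k n).
  have -> : mat (displacement A) k n = (k%:R - n%:R) * mat (displacement T) k n.
    rewrite /mat !displacement_entry !AE /mat -!natr1; ring.
  rewrite normcM nd [X in X * _]mulrC -mulrA -natrM.
  apply: ler_wpM2l; rewrite ?normc_ge0 // ler_nat expnS leq_mul //.
  exact: ltnW (dist_leq k n).
move=> v dv; apply: number_op_dom => k; rewrite ell2D.
have c1 := climD (op_clim (N v) k bT) (op_clim v k bA).
apply: clim_unique c1 _; apply: (@clim_near _ 0%N) (climZ k%:R (op_clim v k bT)).
move=> m _; rewrite mulr_sumr -big_split; apply: eq_bigr => j _ /=.
rewrite AE number_opE // /mat; ring.
Qed.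

(** Multiplying the columns by [n] preserves rapid decay. *)
Lemma rapid_number K : rapid K ->
  exists2 K', rapid K' & forall v, pop_dom N v -> K' v = K (N v).
Proof.
move=> [bK wK].
have wK' p : weighted (fun k n => mat K k n * n%:R) (fun k n => (k.+1 * n.+1) ^ p)%N.
  have [C HC] := wK p.+1; exists C => k n; apply: le_trans (HC k n).
  rewrite normcM normc_nat -mulrA -natrM.
  apply: ler_wpM2l; rewrite ?normc_ge0 // ler_nat expnS leq_mul //; nia.
have [|K' [bK' _] KE] := @offdiag_of_matrix (fun k n => mat K k n * n%:R).
  by move=> p; apply: weighted_leq (wK' p) => k n; apply/leq_expl/dist_leq.
exists K' => [|v dv].
  split=> // p; have [C HC] := wK' p; exists C => k n; rewrite /mat KE; exact: HC.
apply: ell2P => k; apply: clim_unique (op_clim v k bK') _.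
apply: (@clim_near _ 0%N) (op_clim (N v) k bK) => m _; apply: eq_bigr => j _.
rewrite KE number_opE // /mat; ring.
Qed.

Lemma right_shift_dom v : pop_dom N v ->
  pop_dom N (S v) /\ N (S v) = S (N v) + S v.
Proof.
move=> dv; apply: number_op_dom => -[|n]; rewrite ell2D.
  by rewrite /= mulr0 addr0.
by rewrite [LHS]/= number_opE // -natr1 mulrDl mul1r.
Qed.

(** The Leibniz rule gives [L [N, T] + [L, T] N] for the commutator with the
    upper right entry [L N] of the Dirac operator.  Since [N S = S (N + 1)],
    that with the lower left entry is [S [N, T] + [S, T] + [S, T] N].  The
    commutators [[S, T]] and [[L, T]] have rapid decay because [S] and [L] are
    themselves Toeplitz operators. *)
Lemma dirac_commutators T : toeplitz_mod T ->
  exists Cm Cp, [/\ toeplitz_mod Cm, toeplitz_mod Cp,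
    forall v, pop_dom N v -> pop_dom N (T v),
    forall v, pop_dom N v -> Cm v = L (N (T v)) - T (L (N v))
  & forall v, pop_dom N v -> Cp v = N (S (T v)) - T (N (S v))].
Proof.
move=> tT; have [A tA AE] := number_commutator tT.
have [[bT _] _] := tT.
have rS := commutator_rapid (toeplitz_mod_right_shift R) tT.
have rL := commutator_rapid (toeplitz_mod_left_shift R) tT.
have [KS rKS KSE] := rapid_number rS; have [KL rKL KLE] := rapid_number rL.
exists (fun v => L (A v) + KL v), (fun v => S (A v) + (commutator S T v + KS v)); split.
- apply: toeplitz_mod_add; last exact: rapid_toeplitz_mod.
  exact: (toeplitz_mod_comp (toeplitz_mod_left_shift R) tA).
- apply: toeplitz_mod_add; last exact/rapid_toeplitz_mod/rapid_add.
  exact: (toeplitz_mod_comp (toeplitz_mod_right_shift R) tA).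
- by move=> v /AE[].
- move=> v dv; have [_ ->] := AE v dv; rewrite KLE // /commutator.
  by rewrite (bopD _ _ (bounded_left_shift R)) addrA [_ + L (A v)]addrC.
- move=> v dv; have [dTv NTv] := AE v dv.
  have [_ ->] := right_shift_dom dTv; have [_ ->] := right_shift_dom dv.
  rewrite NTv KSE // /commutator (bopD _ _ (bounded_right_shift R)) (bopD _ _ bT).
  by apply: ell2P => k; rewrite !(ell2D, ell2N); ring.
Qed.

End NumberOperator.

(** * Fourier coefficients of smooth periodic functions *)

Section Fourier.
Local Open Scope classical_set_scope.
Variable R : realType.
Implicit Types (h : R -> R) (x t : R).

Local Notation mu := (@lebesgue_measure R).
Local Notation D := `[0%R, 2 * pi]%classic.

(** The Fourier coefficients in real form; [x] ranges over the integers, given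
    as reals satisfying [full_turn]. *)
Definition cos_coef x h : R := \int[mu]_(t in D) (cos (x * t) * h t).
Definition sin_coef x h : R := \int[mu]_(t in D) (sin (x * t) * h t).

Lemma twopi_gt0 : 0 < 2 * pi :> R.
Proof. by rewrite mulr_gt0 ?pi_gt0. Qed.

Lemma continuous_integrable h : continuous h -> mu.-integrable D (EFin \o h).
Proof.
move=> ch; apply: continuous_compact_integrable; first exact: segment_compact.
exact: continuous_subspaceT.
Qed.

Lemma is_derive_scale x t : is_derive t 1 (fun t => x * t) x.
Proof.
have := @is_deriveZ _ _ _ id x t 1 1 (is_derive_id t 1).
by rewrite /GRing.scale /= mulr1.
Qed.

Lemma is_derive_cos_scale x t : is_derive t 1 (fun t => cos (x * t)) (- x * sin (x * t)).
Proof.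
have := is_derive1_comp (is_derive_cos (x * t)) (is_derive_scale x t).
by rewrite mulNr mulrC -mulNr mulNr -mulrN.
Qed.

Lemma is_derive_sin_scale x t : is_derive t 1 (fun t => sin (x * t)) (x * cos (x * t)).
Proof.
have := is_derive1_comp (is_derive_sin (x * t)) (is_derive_scale x t).
by rewrite mulrC.
Qed.

Lemma derivable_continuous h : (forall t, derivable h t 1) -> continuous h.
Proof. by move=> dh t; apply/differentiable_continuous/derivable1_diffP. Qed.

Lemma continuous_cos_scale x : continuous (fun t => cos (x * t)).
Proof.
apply: derivable_continuous => t.
by have [] := is_derive_cos_scale x t.
Qed.

Lemma continuous_sin_scale x : continuous (fun t => sin (x * t)).
Proof.
apply: derivable_continuous => t.
by have [] := is_derive_sin_scale x t.
Qed.

Lemma derivable_LRcontinuous h a b : (forall t, derivable h t 1) ->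
  derivable_oo_LRcontinuous h a b.
Proof.
move=> dh; have ch := derivable_continuous dh.
by split=> [t _||]; [exact: dh|apply: cvg_at_right_filter; exact: ch
  |apply: cvg_at_left_filter; exact: ch].
Qed.

Definition smooth h : Prop := forall n t, derivable (derive1n n h) t 1.

Lemma smooth_continuous h : smooth h -> continuous h.
Proof. by move=> sh; apply: derivable_continuous; apply: sh 0%N. Qed.

Lemma smooth_derive h : smooth h -> smooth h^`().
Proof. by move=> sh n t; have := sh n.+1 t; rewrite /derive1n iterSr. Qed.

Lemma periodic_derive h p : (forall t, h (t + p) = h t) ->
  forall t, h^`() (t + p) = h^`() t.
Proof.
move=> hp t; rewrite /derive1.
have -> // : (fun e : R => e^-1 *: (h (e + (t + p)) - h (t + p))) =
    (fun e : R => e^-1 *: (h (e + t) - h t)).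
by apply/funext => e; rewrite addrA !hp.
Qed.

Definition full_turn x : Prop := cos (x * (2 * pi)) = 1 /\ sin (x * (2 * pi)) = 0.

(** Integration by parts; the boundary terms cancel by periodicity. *)
Lemma coef_derive h x : smooth h -> (forall t, h (t + 2 * pi) = h t) -> full_turn x ->
  x * cos_coef x h = - sin_coef x h^`() /\ x * sin_coef x h = cos_coef x h^`().
Proof.
move=> sh hp [cx sx].
have hend : h (2 * pi) = h 0 by rewrite -(hp 0) add0r.
have ch := smooth_continuous sh; have ch' := smooth_continuous (smooth_derive sh).
have dh t : derivable h t 1 by exact: (sh 0%N t).
have sub (f : R -> R) : continuous f -> {within D, continuous f}.
  by move=> cf; apply: continuous_subspaceT.
split.
  rewrite /sin_coef (@Rintegration_by_parts R (fun t => sin (x * t)) h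
    (fun t => x * cos (x * t)) h^`() 0 (2 * pi) twopi_gt0).
  - rewrite sx mulr0 sin0 !mul0r subr0 sub0r opprK /cos_coef -RintegralZl //=.
      by apply: eq_Rintegral => t _; rewrite mulrA.
    apply: continuous_integrable => t; apply: continuousM; last exact: ch.
    exact: continuous_cos_scale.
  - apply: sub => t; apply: continuousM; first exact: cst_continuous.
    exact: continuous_cos_scale.
  - by apply: derivable_LRcontinuous => t; have [] := is_derive_sin_scale x t.
  - by move=> t _; rewrite derive1E; have [_ ->] := is_derive_sin_scale x t.
  - exact: sub.
  - exact: derivable_LRcontinuous.
  - by move=> t _.
rewrite /cos_coef (@Rintegration_by_parts R (fun t => cos (x * t)) h
    (fun t => - x * sin (x * t)) h^`() 0 (2 * pi) twopi_gt0).
- rewrite cx mulr0 cos0 !mul1r hend subrr sub0r /sin_coef.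
  rewrite -[LHS]opprK -mulNr -RintegralZl //=.
    by congr (- _); apply: eq_Rintegral => t _; rewrite mulrA.
  apply: continuous_integrable => t; apply: continuousM; last exact: ch.
  exact: continuous_sin_scale.
- apply: sub => t; apply: (@continuousM _ _ (fun=> - x) (fun t => sin (x * t))).
    exact: cst_continuous.
  exact: continuous_sin_scale.
- by apply: derivable_LRcontinuous => t; have [] := is_derive_cos_scale x t.
- by move=> t _; rewrite derive1E; have [_ ->] := is_derive_cos_scale x t.
- exact: sub.
- exact: derivable_LRcontinuous.
- by move=> t _.
Qed.

Lemma coef_bound h : continuous h -> exists M : R, forall x,
  `|cos_coef x h| <= M /\ `|sin_coef x h| <= M.
Proof.
move=> ch; exists (\int[mu]_(t in D) `|h t|) => x.
have cn : continuous (fun t => `|h t|).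
  by move=> t; apply: (continuous_comp (ch t)); apply: norm_continuous.
have key (g : R -> R) : continuous g -> (forall t, `|g t| <= 1) ->
    `|\int[mu]_(t in D) (g t * h t)| <= \int[mu]_(t in D) `|h t|.
  move=> cg g1; have cgh : continuous (fun t => g t * h t).
    by move=> t; apply: continuousM; [exact: cg|exact: ch].
  apply: (@le_trans _ _ (\int[mu]_(t in D) `|g t * h t|)).
    by apply: le_normr_Rintegral => //; apply: continuous_integrable.
  apply: le_Rintegral => //.
  - apply: continuous_integrable => t.
    by apply: (continuous_comp (cgh t)); apply: norm_continuous.
  - exact: continuous_integrable.
  - by move=> t _; rewrite normrM ler_piMl.
split; apply: key.
- exact: continuous_cos_scale.
- by move=> t; rewrite ler_norml cos_geN1 cos_le1.
- exact: continuous_sin_scale.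
- by move=> t; rewrite ler_norml sin_geN1 sin_le1.
Qed.

(** [p] integrations by parts turn [x ^ p] times a coefficient of [h] into a
    coefficient of its [p]-th derivative. *)
Lemma coef_decay p h : smooth h -> (forall t, h (t + 2 * pi) = h t) ->
  exists M : R, forall x, full_turn x ->
    `|x| ^+ p * `|cos_coef x h| <= M /\ `|x| ^+ p * `|sin_coef x h| <= M.
Proof.
elim: p h => [|p IH] h sh hp.
  have [M HM] := coef_bound (smooth_continuous sh); exists M => x _.
  by rewrite expr0 !mul1r.
have [M HM] := IH _ (smooth_derive sh) (periodic_derive hp).
exists M => x fx; have [c s] := coef_derive sh hp fx.
have [hc hs] := HM x fx.
by rewrite exprSr -!mulrA -!normrM c s normrN.
Qed.

End Fourier.

(** * Toeplitz operators with smooth symbol *)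

Section Toeplitz.
Local Open Scope classical_set_scope.
Variable R : realType.
Implicit Types (t x : R) (f : R[i] -> R[i]) (T : ell2 R -> ell2 R).

Local Notation mu := (@lebesgue_measure R).
Local Notation D := `[0%R, 2 * pi]%classic.
Local Notation s := ((Num.sqrt (2 * pi))^-1 : R).
Local Notation ip := (@ell2_ip R).
Local Notation bounded := (bounded_operator (@ell2_ip R)).

Lemma expiD t x : expi (t + x) = expi t * expi x.
Proof. by rewrite /expi cosD sinD [X in _ = X]/=; congr (_ +i* _)%C; ring. Qed.

Lemma expi0 : expi (0 : R) = 1.
Proof. by rewrite /expi cos0 sin0. Qed.

Lemma expiX t n : expi t ^+ n = expi (n%:R * t).
Proof.
elim: n => [|n IH]; first by rewrite mul0r expi0.
by rewrite exprSr IH -expiD -natr1 mulrDl mul1r.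
Qed.

Lemma conjc_expi t : conjc (expi t) = expi (- t).
Proof. by rewrite /expi cosN sinN. Qed.

Lemma normc_expi t : normc (expi t) = 1.
Proof. by rewrite /normc /= cos2Dsin2 sqrtr1. Qed.

Lemma expi_periodic t : expi (t + 2 * pi) = expi t.
Proof. by rewrite /expi mulr_natl cosD2pi sinD2pi. Qed.

Lemma full_turn_nat n : full_turn (n%:R : R).
Proof.
have h : expi (n%:R * (2 * pi) : R) = 1.
  by rewrite -expiX -[2 * pi]add0r expi_periodic expi0 expr1n.
by have := congr1 (@complex.Re R) h; have := congr1 (@complex.Im R) h.
Qed.

Lemma full_turn_sub k n : full_turn (k%:R - n%:R : R).
Proof.
have [ck sk] := full_turn_nat k; have [cn sn] := full_turn_nat n.
rewrite /full_turn mulrBl cosB sinB ck sk cn sn; split; ring.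
Qed.

Lemma circle_e_product n k t :
  circle_e n (expi t) * conjc (circle_e k (expi t)) =
  ((s ^+ 2)%:C)%C * expi (- ((k%:R - n%:R) * t)).
Proof.
have conjcM (a b : R[i]) : conjc (a * b) = conjc a * conjc b by exact: rmorphM.
rewrite /circle_e !expiX conjcM conjc_real conjc_expi.
rewrite mulrACA -rmorphM -expr2; congr (_ * _).
rewrite -expiD; congr (expi _); ring.
Qed.

Lemma normc_circle_e n t : normc (circle_e n (expi t)) = s.
Proof.
rewrite /circle_e normcM normcX normc_expi expr1n mulr1 normc_real ger0_norm //.
Qed.

Lemma circle_e_L2 n : circle_L2 (@circle_e R n).
Proof.
have reE : re_circle (@circle_e R n) = (fun t => s * cos (n%:R * t)).
  by apply/funext => t; rewrite /re_circle /circle_e expiX /=; ring.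
have imE : im_circle (@circle_e R n) = (fun t => s * sin (n%:R * t)).
  by apply/funext => t; rewrite /im_circle /circle_e expiX /=; ring.
split.
- rewrite reE; apply: measurable_funTS; apply: continuous_measurable_fun => t.
  apply: (@continuousM _ _ (fun=> s) (fun t => cos (n%:R * t))).
    exact: cst_continuous.
  exact: continuous_cos_scale.
- rewrite imE; apply: measurable_funTS; apply: continuous_measurable_fun => t.
  apply: (@continuousM _ _ (fun=> s) (fun t => sin (n%:R * t))).
    exact: cst_continuous.
  exact: continuous_sin_scale.
under eq_integral do rewrite normc_circle_e.
rewrite integral_cst //= lebesgue_measure_itv /= lte_fin twopi_gt0.
by rewrite -EFinD -EFinM ltry.
Qed.

(** The partial sums of the expansion of a basis vector are eventually exact. *)
Lemma represents_e n : represents (e_ R n) (@circle_e R n).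
Proof.
split; first exact: circle_e_L2.
apply: cvg_near_cst; exists n.+1 => // m /= nm.
have -> : (fun z : R[i] => circle_e n z - \sum_(k < m) e_ R n k * circle_e k z) = (fun=> 0).
  apply/funext => z; rewrite (bigD1 (Ordinal nm)) //= eqxx mul1r big1 ?addr0 ?subrr //.
  move=> i ni; rewrite (_ : (i == n :> nat) = false) ?mul0r //.
  by apply: contraNF ni => /eqP ni; apply/eqP/val_inj.
rewrite /circle_norm /circle_ip /circle_int /re_circle /=.
under eq_Rintegral => t _ do rewrite mul0r /=.
by rewrite Rintegral_cst // !mul0r subr0 mul0r sqrtr0.
Qed.

(** The Fourier coefficient of [f] of index [x], as a function of the real and
    imaginary parts of [f] along the circle. *)
Definition fourier_entry f x : R[i] :=
  ((s ^+ 2 * (cos_coef x (re_circle f) + sin_coef x (im_circle f)))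
   +i* (s ^+ 2 * (cos_coef x (im_circle f) - sin_coef x (re_circle f))))%C.

Lemma toeplitz_entry f T k n : circle_smooth f -> is_toeplitz f T ->
  T (e_ R n) k = fourier_entry f (k%:R - n%:R).
Proof.
move=> sf [_ /(_ _ _ (represents_e n))/(_ k) ->].
have cu : continuous (re_circle f).
  by apply: derivable_continuous => t; exact: (sf 0%N t).1.
have cv : continuous (im_circle f).
  by apply: derivable_continuous => t; exact: (sf 0%N t).2.
set x : R := k%:R - n%:R.
have cgh (g h : R -> R) : continuous g -> continuous h ->
    continuous (fun t => g t * h t).
  by move=> cg ch t; apply: continuousM; [exact: cg|exact: ch].
have ci (g h : R -> R) : continuous g -> continuous h ->
    mu.-integrable D (EFin \o (fun t => g t * h t)).
  by move=> cg ch; apply/continuous_integrable/cgh.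
have cc := @continuous_cos_scale R x; have cs := @continuous_sin_scale R x.
have ent t : f (expi t) * circle_e n (expi t) * conjc (circle_e k (expi t)) =
    ((s ^+ 2 * (cos (x * t) * re_circle f t + sin (x * t) * im_circle f t))
    +i* (s ^+ 2 * (cos (x * t) * im_circle f t - sin (x * t) * re_circle f t)))%C.
  rewrite -mulrA circle_e_product /re_circle /im_circle.
  case: (f (expi t)) => u v; rewrite /expi cosN sinN -/x /=.
  by congr (_ +i* _)%C; ring.
rewrite /circle_ip /circle_int /fourier_entry; congr (_ +i* _)%C.
  rewrite /cos_coef /sin_coef -RintegralD ?ci // -RintegralZl //.
    by apply: eq_Rintegral => t _; rewrite /re_circle ent.
  apply: continuous_integrable => t.
  exact: cvgD (cgh _ _ cc cu t) (cgh _ _ cs cv t).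
rewrite /cos_coef /sin_coef -RintegralB ?ci // -RintegralZl //.
  by apply: eq_Rintegral => t _; rewrite /im_circle ent.
apply: continuous_integrable => t.
exact: cvgB (cgh _ _ cc cv t) (cgh _ _ cs cu t).
Qed.

(** The entry [(k, n)] depends on [k - n] only, so that the displacement
    vanishes, and smoothness gives the decay away from the diagonal. *)
Lemma toeplitz_mod_symbol f T : circle_smooth f -> is_toeplitz f T -> toeplitz_mod T.
Proof.
move=> sf tT; have bT : bounded T by have [] := tT.
have ent k n := toeplitz_entry k n sf tT.
split; last first.
  split=> [|p]; first exact: bounded_displacement.
  exists 0 => k n; rewrite /mat displacement_entry !ent.
  have -> : k.+1%:R - n.+1%:R = k%:R - n%:R :> R by rewrite -!natr1; ring.
  by rewrite subrr normc0 mul0r.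
split=> // p.
have [su sv] : smooth (re_circle f) /\ smooth (im_circle f).
  by split=> n t; have [] := sf n t.
have pu t : re_circle f (t + 2 * pi) = re_circle f t by rewrite /re_circle expi_periodic.
have pv t : im_circle f (t + 2 * pi) = im_circle f t by rewrite /im_circle expi_periodic.
have bnd q : exists C : R, forall k n, normc (T (e_ R n) k) * (dist k n)%:R ^+ q <= C.
  have [M HM] := coef_decay q su pu; have [M' HM'] := coef_decay q sv pv.
  exists (s ^+ 2 * (M + M' + (M' + M))) => k n; rewrite ent.
  rewrite dist_normr; have [h1 h2] := HM _ (full_turn_sub k n).
  have [h3 h4] := HM' _ (full_turn_sub k n).
  set x := k%:R - n%:R in h1 h2 h3 h4 *.
  have xq : 0 <= `|x| ^+ q by rewrite exprn_ge0.
  apply: (@le_trans _ _ ((s ^+ 2 * (`|cos_coef x (re_circle f)| + `|sin_coef x (im_circle f)|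
    + (`|cos_coef x (im_circle f)| + `|sin_coef x (re_circle f)|))) * `|x| ^+ q)).
    apply: ler_wpM2r => //; apply: le_trans (normc_le_ReIm _) _ => /=.
    rewrite !normrM ger0_norm ?sqr_ge0 // -mulrDr; apply: ler_wpM2l; rewrite ?sqr_ge0 //.
    by apply: lerD; [exact: ler_normD|exact: ler_normB].
  rewrite -mulrA; apply: ler_wpM2l; first exact: sqr_ge0.
  by rewrite mulrC !mulrDr; apply: lerD; apply: lerD.
have [[C1 H1] [C2 H2]] := (bnd 0%N, bnd p).
exists ((2 ^ p)%N%:R * (C1 + C2)) => k n; rewrite /mat.
apply: le_trans (ler_wpM2l (normc_ge0 _) (succ_expn_le R p (dist k n))) _.
rewrite mulrCA; apply: ler_wpM2l => //; rewrite mulrDr; apply: lerD.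
  exact: H1.
exact: H2.
Qed.

End Toeplitz.

(** * The real structure *)

Section Conjugation.
Variable R : realType.
Implicit Types (T a b : ell2 R -> ell2 R) (u v w : ell2 R).

Local Notation ip := (@ell2_ip R).
Local Notation nm := (ip_norm (@ell2_ip R)).
Local Notation bounded := (bounded_operator (@ell2_ip R)).

Lemma conj_seq_summable v : (fun n => conjc (v n)) \in @square_summable R.
Proof.
apply: (@square_summable_bound _ _ (ssq v)) => m.
by under eq_bigr do rewrite normc_conj; apply: sum_le_ssq.
Qed.

Definition conj_seq v : ell2 R := Ell2 (conj_seq_summable v).

Lemma conj_seqE v n : conj_seq v n = conjc (v n). Proof. by []. Qed.

Lemma conj_seqK : involutive conj_seq.
Proof. by move=> v; apply: ell2P => n; rewrite !conj_seqE conjcK. Qed.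

Lemma conj_seqD u v : conj_seq (u + v) = conj_seq u + conj_seq v.
Proof. by apply: ell2P => n; rewrite ell2D !conj_seqE ell2D rmorphD. Qed.

Lemma conj_seqN v : conj_seq (- v) = - conj_seq v.
Proof. by apply: ell2P => n; rewrite ell2N !conj_seqE ell2N rmorphN. Qed.

Lemma conj_seqZ c v : conj_seq (c *: v) = conjc c *: conj_seq v.
Proof. by apply: ell2P => n; rewrite ell2Z !conj_seqE ell2Z rmorphM. Qed.

Lemma conj_seq_e k : conj_seq (e_ R k) = e_ R k.
Proof. by apply: ell2P => n; rewrite conj_seqE e_E conjc_nat. Qed.

Lemma conj_seq0 : conj_seq 0 = 0.
Proof. by apply: ell2P => n; rewrite conj_seqE ell20 conjc0. Qed.

Lemma norm_conj_seq v : nm (conj_seq v) = nm v.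
Proof.
rewrite !ell2_normE /ssq; congr (Num.sqrt (limn (series _))).
by apply/funext => n; rewrite conj_seqE normc_conj.
Qed.

Lemma ip_conj_seq u v : ip (conj_seq u) (conj_seq v) = conjc (ip u v).
Proof.
apply: clim_unique (ip_clim _ _) _.
apply: (@clim_near _ 0%N) (clim_conj (ip_clim u v)) => m _.
by rewrite rmorph_sum; apply: eq_bigr => i _; rewrite !conj_seqE rmorphM.
Qed.

Definition conj_op T : ell2 R -> ell2 R := fun v => conj_seq (T (conj_seq v)).

Lemma bounded_conj_op T : bounded T -> bounded (conj_op T).
Proof.
move=> bT; split.
  move=> c u v; rewrite /conj_op conj_seqD conj_seqZ (bopD _ _ bT) (bopZ _ _ bT).
  by rewrite conj_seqD conj_seqZ conjcK.
have [M M0 HM] := bop_bound bT.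
by exists M => v; rewrite /conj_op norm_conj_seq -(norm_conj_seq v).
Qed.

Lemma conj_op_entry T k n : conj_op T (e_ R n) k = conjc (T (e_ R n) k).
Proof. by rewrite /conj_op conj_seq_e. Qed.

Lemma toeplitz_mod_conj_op T : toeplitz_mod T -> toeplitz_mod (conj_op T).
Proof.
move=> [[bT wT] [_ dT]]; have bcT := bounded_conj_op bT; split.
  split=> // p; have [C HC] := wT p; exists C => k n.
  by rewrite /mat conj_op_entry normc_conj; apply: HC.
split=> [|p]; first exact: bounded_displacement.
have [C HC] := dT p; exists C => k n; apply: le_trans (HC k n).
by rewrite /mat !displacement_entry !conj_op_entry -rmorphB normc_conj.
Qed.

End Conjugation.

Section Hilbert.
Variable R : realType.
Implicit Types (u v w : hilbert R) (J : hilbert R -> hilbert R).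

Local Notation ip := (@ell2_ip R).
Local Notation nm := (ip_norm (@ell2_ip R)).
Local Notation hip := (@H_ip R).
Local Notation hnm := (ip_norm (@H_ip R)).
Local Notation r := (((Num.sqrt 2)^-1 : R)%:C)%C.

Lemma hnormE v : hnm v = Num.sqrt (nm v.1 ^+ 2 + nm v.2 ^+ 2).
Proof. by rewrite {1}/ip_norm /H_ip !ip_self -rmorphD. Qed.

Lemma hnorm_le v : hnm v <= nm v.1 + nm v.2.
Proof.
have s0 : 0 <= nm v.1 + nm v.2 by rewrite addr_ge0 ?ell2_norm_ge0.
rewrite hnormE -[leRHS]ger0_norm // -sqrtr_sqr ler_wsqrtr // sqrrD -addrA lerD2l.
by rewrite lerDr mulrn_wge0 // mulr_ge0 ?ell2_norm_ge0.
Qed.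

Lemma rr2 : r * r * 2 = 1 :> R[i].
Proof.
have -> : 2 = ((2 : R)%:C)%C :> R[i] by rewrite rmorph_nat.
rewrite -!rmorphM -expr2 exprVn sqr_sqrtr // mulVf ?rmorph1 //.
Qed.

Lemma r_neq0 : r != 0 :> R[i].
Proof. by apply/eqP => h; have := rr2; rewrite h !mul0r => /esym/eqP; rewrite oner_eq0. Qed.

Lemma b0E : b_ R 0 = (0, e_ R 0). Proof. by []. Qed.
Lemma bposE k : b_ R (Posz k.+1) = (r *: e_ R k, r *: e_ R k.+1). Proof. by []. Qed.
Lemma bnegE k : b_ R (Negz k) = (r *: - e_ R k, r *: e_ R k.+1). Proof. by []. Qed.

Lemma hip_b0 v : hip v (b_ R 0) = v.2 0%N.
Proof. by rewrite b0E /H_ip ip0r add0r ip_e_r. Qed.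

Lemma hip_bpos v k : hip v (b_ R (Posz k.+1)) = r * (v.1 k + v.2 k.+1).
Proof. by rewrite bposE /H_ip !ipZr !ip_e_r conjc_real mulrDr. Qed.

Lemma hip_bneg v k : hip v (b_ R (Negz k)) = r * (- v.1 k + v.2 k.+1).
Proof. by rewrite bnegE /H_ip !ipZr ipNr !ip_e_r conjc_real mulrDr. Qed.

(** Sums and differences of the products with [b_ k] and [b_ (- k)] recover the
    coordinates of the vector. *)
Lemma hip_ext u w : (forall k : int, hip u (b_ R k) = hip w (b_ R k)) -> u = w.
Proof.
move=> h; have h0 := h 0; rewrite !hip_b0 in h0.
have hk k : u.1 k = w.1 k /\ u.2 k.+1 = w.2 k.+1.
  have := h (Posz k.+1); have := h (Negz k); rewrite !hip_bneg !hip_bpos.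
  move=> /(mulfI r_neq0) e1 /(mulfI r_neq0) e2; split.
    have : (u.1 k + u.2 k.+1) - (- u.1 k + u.2 k.+1) =
           (w.1 k + w.2 k.+1) - (- w.1 k + w.2 k.+1) by rewrite e1 e2.
    have two : (2 : R[i]) != 0 by rewrite pnatr_eq0.
    move=> e; apply: (mulfI two); rewrite !mulr2n !mulrDl !mul1r.
    by move: e; rewrite !opprD !opprK; move=> e; ring: e.
  have : (u.1 k + u.2 k.+1) + (- u.1 k + u.2 k.+1) =
         (w.1 k + w.2 k.+1) + (- w.1 k + w.2 k.+1) by rewrite e1 e2.
  have two : (2 : R[i]) != 0 by rewrite pnatr_eq0.
  by move=> e; apply: (mulfI two); ring: e.
rewrite [u]surjective_pairing [w]surjective_pairing; congr (_, _).
  by apply: ell2P => k; have [] := hk k.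
by apply: ell2P => -[|k] //; have [] := hk k.
Qed.

Lemma b0_fst n : (b_ R (Posz 0)).1 n = 0. Proof. by []. Qed.
Lemma b0_snd n : (b_ R (Posz 0)).2 n = (n == 0%N)%:R. Proof. by []. Qed.
Lemma bpos_fst k n : (b_ R (Posz k.+1)).1 n = r * (n == k)%:R.
Proof. by []. Qed.
Lemma bpos_snd k n : (b_ R (Posz k.+1)).2 n = r * (n == k.+1)%:R.
Proof. by []. Qed.
Lemma bneg_fst k n : (b_ R (Negz k)).1 n = - (r * (n == k)%:R).
Proof. by rewrite -mulrN. Qed.
Lemma bneg_snd k n : (b_ R (Negz k)).2 n = r * (n == k.+1)%:R.
Proof. by []. Qed.
Let bE := (b0_fst, b0_snd, bpos_fst, bpos_snd, bneg_fst, bneg_snd).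

Lemma b_orthonormal i j : hip (b_ R i) (b_ R j) = (i == j)%:R.
Proof.
have rv : r * r *+ 2 = 1 by rewrite -rr2 mulr_natr.
have key (k l : nat) : r * (r * (k == l)%:R + r * (k == l)%:R) = (k == l)%:R :> R[i].
  by rewrite -mulrDl mulrA mulrDr -mulr2n rv mul1r.
case: j => [[|j]|j]; rewrite ?hip_b0 ?hip_bpos ?hip_bneg;
  case: i => [[|i]|i]; rewrite !bE ?mulr0 ?eqSS ?(addrC (- _)) ?subrr ?mulr0 //.
all: by rewrite ?opprK ?key ?addr0 ?mulr0 // eq_sym.
Qed.

Lemma hip_expand v k :
  hip v (b_ R (Posz k.+1)) *: b_ R (Posz k.+1) + hip v (b_ R (Negz k)) *: b_ R (Negz k)
  = (v.1 k *: e_ R k, v.2 k.+1 *: e_ R k.+1).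
Proof.
rewrite hip_bpos hip_bneg bposE bnegE; congr (_, _) => /=.
  rewrite !scalerN !scalerA -scaleNr -scalerDl; congr (_ *: _).
  by rewrite -[RHS]mul1r -rr2; ring.
rewrite !scalerA -scalerDl; congr (_ *: _).
by rewrite -[RHS]mul1r -rr2; ring.
Qed.

Lemma sum_pair m (F G : nat -> ell2 R) :
  \sum_(k < m) ((F k, G k) : hilbert R) = (\sum_(k < m) F k, \sum_(k < m) G k).
Proof. by elim: m => [|m IH]; rewrite ?big_ord0 // !big_ord_recr /= IH. Qed.

Lemma b_dense v (eps : R) : 0 < eps -> exists (s : seq int) (c : int -> R[i]),
  hnm (v - \sum_(i <- s) c i *: b_ R i) < eps.
Proof.
move=> e0; have e2 : 0 < eps / 2 by rewrite divr_gt0.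
(* The vector [e_ k] of the first component is paired with [e_ k.+1] of the
   second, whence the two lengths [m] and [m.+1] of the truncations. *)
have [M1 H1] := trunc_cvg v.1 e2; have [M2 H2] := trunc_cvg v.2 e2.
pose m := maxn M1 M2.
exists (0%:Z :: [seq Posz k.+1 | k <- index_iota 0 m] ++ [seq Negz k | k <- index_iota 0 m]).
exists (fun k => hip v (b_ R k)).
rewrite big_cons big_cat /= !big_map !big_mkord -big_split /=.
rewrite (eq_bigr (fun k : 'I_m => (v.1 k *: e_ R k, v.2 k.+1 *: e_ R k.+1) : hilbert R));
  last by move=> k _; apply: hip_expand.
rewrite (sum_pair m (fun k => v.1 k *: e_ R k) (fun k => v.2 k.+1 *: e_ R k.+1)).
have -> : hip v (b_ R 0) *: b_ R 0 +
    (\sum_(k < m) v.1 k *: e_ R k, \sum_(k < m) v.2 k.+1 *: e_ R k.+1) =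
    (trunc m v.1, trunc m.+1 v.2) :> hilbert R.
  rewrite hip_b0 b0E; congr (_, _) => /=; first by rewrite scaler0 add0r.
  by rewrite /trunc big_ord_recl.
apply: le_lt_trans (hnorm_le _) _; rewrite (splitr eps); apply: ltr_leD.
  by apply: H1; apply: leq_maxl.
by apply/ltW/H2; apply: leq_trans (leq_maxr M1 M2) _.
Qed.

(** In the decomposition of the Hilbert space into two copies of the sequence
    space, the reality operator is diagonal up to complex conjugation. *)
Definition reality v : hilbert R := (- conj_seq v.1, conj_seq v.2).

Lemma realityK : involutive reality.
Proof. by move=> [v1 v2]; rewrite /reality /= conj_seqN !conj_seqK opprK. Qed.

Lemma reality_antiunitary : antiunitary hip reality.
Proof.
split=> [a u v|u v|v]; last by exists (reality v); rewrite realityK.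
  rewrite /reality; congr (_, _) => /=; rewrite conj_seqD conj_seqZ //.
  by rewrite opprD scalerN.
by rewrite /H_ip /reality /= ipNl ipNr opprK !ip_conj_seq rmorphD.
Qed.

Lemma reality_b k : reality (b_ R k) = b_ R (- k).
Proof.
case: k => [[|k]|k].
- by rewrite oppr0 b0E /reality /= conj_seq0 oppr0 conj_seq_e.
- rewrite bposE -NegzE bnegE /reality /= !conj_seqZ !conj_seq_e conjc_real.
  by rewrite scalerN.
- rewrite NegzE opprK bposE -NegzE bnegE /reality /= !conj_seqZ conj_seqN.
  by rewrite !conj_seq_e conjc_real scalerN opprK.
Qed.

(** An antiunitary map is determined by its values on the [b_ k], because its
    products with them are: [J v] against [J (b_ k)] is the conjugate of [v]
    against [b_ k]. *)
Lemma reality_unique J : antiunitary hip J ->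
  (forall k : int, J (b_ R k) = b_ R (- k)) -> J = reality.
Proof.
move=> [_ Jip _] Jb; have [_ rip _] := reality_antiunitary.
apply/funext => v; apply: hip_ext => k.
by rewrite -{1}(opprK k) -Jb Jip -rip reality_b opprK.
Qed.

Local Notation N := (number_op R).
Local Notation S := (@right_shift R).
Local Notation L := (adjoint ip S).

Lemma number_conj_seq (v : ell2 R) : pop_dom N v ->
  pop_dom N (conj_seq v) /\ N (conj_seq v) = conj_seq (N v).
Proof.
by move=> dv; apply: number_op_dom => n; rewrite !conj_seqE number_opE // rmorphM rmorph_nat.
Qed.

Lemma number_opp (v : ell2 R) : pop_dom N v ->
  pop_dom N (- v) /\ N (- v) = - N v.
Proof.
by move=> dv; apply: number_op_dom => n; rewrite !ell2N number_opE // mulrN.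
Qed.

(** The Dirac operator is off-diagonal with real coefficients, and the two
    diagonal entries of [reality] have opposite signs. *)
Lemma reality_dirac :
  pop_eq (pop_compl reality (dirac_op R)) (pop_opp (pop_compr (dirac_op R) reality)).
Proof.
have domJ v : pop_dom (dirac_op R) v -> pop_dom (dirac_op R) (reality v).
  move=> [/number_conj_seq[d1 _] /number_conj_seq[d2 _]]; split=> //.
  by have [] := number_opp d1.
split.
  apply/seteqP; split=> v d; first exact: domJ.
  by rewrite -(realityK v); apply: domJ.
move=> v [d1 d2].
have [cd1 _] := number_conj_seq d1; have [cd2 E2] := number_conj_seq d2.
have [Sd1 _] := right_shift_dom d1.
have E3 : S (- conj_seq v.1) = - conj_seq (S v.1).
  by apply: ell2P => -[|n]; rewrite ell2N conj_seqE /= ?conjc0 ?oppr0.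
have [cSd1 E4] := number_conj_seq Sd1.
have [_ E5] := number_opp cSd1.
have G1 : - conj_seq (L (N v.2)) = - L (N (conj_seq v.2)).
  rewrite E2; congr (- _).
  by apply: ell2P => n; rewrite conj_seqE !left_shiftE conj_seqE.
have G2 : conj_seq (N (S v.1)) = - N (S (- conj_seq v.1)).
  by rewrite E3 E5 E4 opprK.
exact: (congr2 pair G1 G2).
Qed.

(** The signs cancel, so that the algebra is conjugated entrywise. *)
Lemma reality_rep (b : ell2 R -> ell2 R) v : bounded_operator ip b ->
  reality (rep b (reality v)) = rep (conj_op b) v.
Proof.
by move=> bb; rewrite /reality /rep /conj_op /= (bopN _ bb) conj_seqN opprK.
Qed.

(** The class contains both kinds of generators and is closed under all the
    operations that generate the algebra. *)
Lemma algA_toeplitz_mod g (a : ell2 R -> ell2 R) : algA g a -> toeplitz_mod a.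
Proof.
elim=> [T [/rapid_decayP/rapid_toeplitz_mod//|[f [sf _]]]|T T' _ h _ h'|c T _ h
  |T T' _ h _ h'|T _ h].
- exact: toeplitz_mod_symbol.
- exact: toeplitz_mod_add.
- exact: toeplitz_mod_scale.
- exact: toeplitz_mod_comp.
- exact: toeplitz_mod_adjoint.
Qed.

Lemma rapid_decay_H_diag (A B : ell2 R -> ell2 R) : rapid A -> rapid B ->
  rapid_decay_H (fun v => (A v.1, B v.2)).
Proof.
move=> rA rB; exists A, (fun=> 0), (fun=> 0), B; split;
  try by apply/rapid_decayP => //; apply: rapid_zero.
by move=> v; rewrite addr0 add0r.
Qed.

Lemma rapid_decay_H_antidiag (A B : ell2 R -> ell2 R) : rapid A -> rapid B ->
  rapid_decay_H (fun v => (A v.2, B v.1)).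
Proof.
move=> rA rB; exists (fun=> 0), A, B, (fun=> 0); split;
  try by apply/rapid_decayP => //; apply: rapid_zero.
by move=> v; rewrite addr0 add0r.
Qed.

Lemma bounded_antidiag (A B : ell2 R -> ell2 R) :
  bounded_operator ip A -> bounded_operator ip B ->
  bounded_operator hip (fun v => (A v.2, B v.1)).
Proof.
move=> bA bB; split.
  move=> a u v; congr (_, _) => /=.
    by rewrite (bopD _ _ bA) (bopZ _ _ bA).
  by rewrite (bopD _ _ bB) (bopZ _ _ bB).
have [[M M0 HM] [K K0 HK]] := (bop_bound bA, bop_bound bB).
exists (M + K) => v; rewrite !hnormE /=.
have s0 : 0 <= nm v.1 ^+ 2 + nm v.2 ^+ 2 by rewrite addr_ge0 ?sqr_ge0.
rewrite -(ger0_norm (addr_ge0 M0 K0)) -sqrtr_sqr -sqrtrM ?sqr_ge0 //.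
apply: ler_wsqrtr; rewrite mulrDr addrC; apply: lerD.
  rewrite -exprMn ler_pXn2r ?nnegrE ?mulr_ge0 ?addr_ge0 ?ell2_norm_ge0 //.
  by apply: le_trans (HK _) _; apply: ler_wpM2r; rewrite ?ell2_norm_ge0 // lerDr.
rewrite -exprMn ler_pXn2r ?nnegrE ?mulr_ge0 ?addr_ge0 ?ell2_norm_ge0 //.
by apply: le_trans (HM _) _; apply: ler_wpM2r; rewrite ?ell2_norm_ge0 // lerDl.
Qed.

End Hilbert.

Theorem proposition3p6 (R : realType) (g : nat) :
  orthonormal_basis (@H_ip R) (@b_ R) /\
  (exists! J : hilbert R -> hilbert R,
     antiunitary (@H_ip R) J /\ forall k : int, J (b_ R k) = b_ R (- k)) /\
  (forall J Jinv : hilbert R -> hilbert R,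
     antiunitary (@H_ip R) J ->
     (forall k : int, J (b_ R k) = b_ R (- k)) ->
     cancel J Jinv -> cancel Jinv J ->
     [/\ forall v, J (J v) = v,
         pop_eq (pop_compl J (dirac_op R)) (pop_opp (pop_compr (dirac_op R) J)),
         forall a b, algA g a -> algA g b ->
           rapid_decay_H (commutator (rep a) (J \o rep b \o Jinv))
       & forall a b, algA g a -> algA g b ->
           exists C, bounded_commutator (@H_ip R) (dirac_op R) (rep a) C /\
             rapid_decay_H (commutator C (J \o rep b \o Jinv))]).
Proof.
split; first by split; [exact: b_orthonormal|exact: b_dense].
split.
  exists (@reality R); split.
    by split; [exact: reality_antiunitary|exact: reality_b].
  by move=> J [aJ Jb]; rewrite (reality_unique aJ Jb).
move=> J Jinv aJ Jb JK KJ; rewrite {aJ Jb}(reality_unique aJ Jb) in JK KJ *.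
have -> : Jinv = @reality R.
  by apply/funext => v; rewrite -{1}(realityK v) JK.
have conj_rep b v : algA g b ->
    (@reality R \o rep b \o @reality R) v = rep (conj_op b) v.
  by move=> /algA_toeplitz_mod[[bb _] _]; apply: reality_rep.
split; [exact: realityK|exact: reality_dirac| |].
  move=> a b Aa Ab.
  have ta := algA_toeplitz_mod Aa.
  have tb := toeplitz_mod_conj_op (algA_toeplitz_mod Ab).
  have := rapid_decay_H_diag (commutator_rapid ta tb) (commutator_rapid ta tb).
  by congr rapid_decay_H; apply/funext => v; rewrite /commutator !conj_rep.
move=> a b Aa Ab.
have tb := toeplitz_mod_conj_op (algA_toeplitz_mod Ab).
have [Cm [Cp [tm tp ad Em Ep]]] := dirac_commutators (algA_toeplitz_mod Aa).
exists (fun v => (Cm v.2, Cp v.1)); split; last first.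
  have := rapid_decay_H_antidiag (commutator_rapid tm tb) (commutator_rapid tp tb).
  by congr rapid_decay_H; apply/funext => v; rewrite /commutator !conj_rep.
split=> [|v [d1 d2]|v [d1 d2]].
- by apply: bounded_antidiag; [have [[]] := tm|have [[]] := tp].
- by split; apply: ad.
- by rewrite /= (Em _ d2) (Ep _ d1).
Qed.
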